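(* Let $H\in(0,\tfrac12]$, $\sigma\in\mathbb{R}\setminus\{0\}$, and for $\lambda<\lambda^*$ let $(x_t)$ be the stationary solution of the scalar equation $$\mathrm{d}x_t=A(\lambda)\,x_t\,\mathrm{d}t+\sigma\,\mathrm{d}W^H_t ,$$ with spectral density $S_x$. Then $S_x^{\max}:=\max_{\omega\in\mathbb{R}}S_x(\omega)$ is well-defined and $$|S_x^{\max}|\asymp|A(\lambda)|^{-1-2H}\qquad\text{as }\lambda\to\lambda^*.$$
   Context: $A:(-\infty,\lambda^*]\to\mathbb{R}$ is continuous with $A(\lambda)<0$ for $\lambda<\lambda^*$ and $A(\lambda^* )=0$. $(W^H_t)$ is a scalar fractional Brownian motion with Hurst index $H$ (two-sided, for the stationary solution $x_t=\sigma\int_{-\infty}^te^{A(\lambda)(t-u)}\,\mathrm{d}W^H_u$): a centered Gaussian process with $\mathbb{E}[W^H_tW^H_s]=\tfrac12(|t|^{2H}+|s|^{2H}-|t-s|^{2H})$. For a weakly stationary process with autocovariance $V(\tau)=\mathbb{E}[x_tx_{t+\tau}]-\mathbb{E}[x_t]\mathbb{E}[x_{t+\tau}]$, $\tau\in\mathbb{R}$, the spectral density is $S_x(\omega)=\frac1{2\pi}\int_{\mathbb{R}}e^{-i\omega\tau}V(\tau)\,\mathrm{d}\tau$. The quantity $S_x^{\max}$ is defined when $S_x$ is bounded and $S_x(\omega)\to0$ as $\omega\to\pm\infty$; ''well-defined'' means these conditions hold and the maximum is attained. For functions of $\lambda$, $|b_1(\lambda)|\asymp|b_2(\lambda)|$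 means $0<\liminf_{\lambda\to\lambda^*}|b_1/b_2|\le\limsup_{\lambda\to\lambda^*}|b_1/b_2|<\infty$, with $\lambda\to\lambda^*$ from below. *)

(* Defs.v *)
From HB Require Import structures.
From mathcomp Require Import all_boot all_order all_algebra.
From mathcomp Require Import all_classical all_reals all_analysis.
From mathcomp Require Export complex.

Set Implicit Arguments.
Unset Strict Implicit.
Unset Printing Implicit Defensive.

Import Order.TTheory GRing.Theory Num.Theory.
Import numFieldNormedType.Exports.

Local Open Scope classical_set_scope.
Local Open Scope complex_scope.
Local Open Scope ring_scope.

Section processes.
Context {R : realType} {d : measure_display} {T : measurableType d}.
Context {P : probability T R}.
Implicit Types W x : R -> {RV P >-> R}.

(* [normal_prob m 0] is not the point mass at m, hence the case distinction. *)
Definition gaussian_law (m s : R) (B : set R) : \bar R :=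
  if s == 0 then dirac m B else normal_prob m s B.

Definition is_gaussian (X : T -> R) : Prop :=
  exists m s : R, forall B : set R, measurable B ->
    P (X @^-1` B) = gaussian_law m s B.

Definition gaussian_process W : Prop :=
  forall (n : nat) (t c : 'I_n -> R),
    is_gaussian (fun w => \sum_(i < n) c i * W (t i) w).

Definition fractional_brownian_motion (H : R) W : Prop :=
  [/\ gaussian_process W,
      forall t, ('E_P[W t] = 0)%E &
      forall t s, ('E_P[(W t \* W s)%R])%E =
        (2^-1 * (`|t| `^ (2 * H) + `|s| `^ (2 * H)
                 - `|t - s| `^ (2 * H)))%:E].

Definition ms_error (X Y : T -> R) : \bar R :=
  ('E_P[(fun w => (X w - Y w) ^+ 2)%R])%E.

(* As for [variation], the subdivision a = a_0 < a_1 < ... < a_n = b is encoded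
   by s = [:: a_1; ...; a_n]; c i is the tag chosen in [a_i, a_{i+1}]. *)
Definition tagged_partition (a b : R) (s : seq R) (c : nat -> R) : Prop :=
  itv_partition a b s /\
  forall i, (i < size s)%N -> nth b (a :: s) i <= c i <= nth b (a :: s) i.+1.

Definition mesh_lt (a b : R) (s : seq R) (delta : R) : Prop :=
  forall i, (i < size s)%N -> nth b (a :: s) i.+1 - nth b (a :: s) i < delta.

Definition RS_sum (f : R -> R) W (a b : R) (s : seq R) (c : nat -> R)
    (w : T) : R :=
  \sum_(0 <= i < size s)
    f (c i) * (W (nth b (a :: s) i.+1) w - W (nth b (a :: s) i) w).

(* I is the integral of the deterministic function f against dW over [a, b],
   as a limit in L^2(P) of Riemann-Stieltjes sums. *)
Definition is_wiener_integral (f : R -> R) W (a b : R) (I : {RV P >-> R}) :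
    Prop :=
  forall eps : R, 0 < eps -> exists2 delta : R, 0 < delta &
    forall (s : seq R) (c : nat -> R),
      tagged_partition a b s c -> mesh_lt a b s delta ->
      (ms_error (RS_sum f W a b s c) I < eps%:E)%E.

(* The same over ]-oo, b], as a limit in L^2(P) of integrals over [a, b]. *)
Definition is_wiener_integral_Noo (f : R -> R) W (b : R) (I : {RV P >-> R}) :
    Prop :=
  exists2 J : R -> {RV P >-> R},
    (forall a, a < b -> is_wiener_integral f W a b (J a)) &
    ms_error (J a) I @[a --> -oo] --> 0%E.

(* The stationary solution of dx_t = A x_t dt + sigma dW_t for A < 0, i.e.
   x_t = sigma * \int_{-oo}^t exp (A (t - u)) dW_u almost surely. *)
Definition stationary_solution W (A sigma : R) x : Prop :=
  forall t, exists2 I : {RV P >-> R},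
    is_wiener_integral_Noo (fun u => expR (A * (t - u))) W t I &
    {ae P, forall w, x t w = sigma * I w}.

Definition cov x (s t : R) : \bar R :=
  ('E_P[(x s \* x t)%R] - 'E_P[x s] * 'E_P[x t])%E.

Definition weakly_stationary x : Prop :=
  [/\ forall t, ('E_P[(x t \* x t)%R] < +oo)%E,
      forall t, ('E_P[x t] = 'E_P[x 0%R])%E &
      forall t tau, cov x t (t + tau) = cov x 0 tau].

(* For a weakly stationary process the base time 0 is immaterial. *)
Definition autocovariance x (tau : R) : R := fine (cov x 0 tau).

End processes.

Section spectral.
Context {R : realType}.

Definition complex_integral (f : R -> R[i]) : R[i] :=
  (\int[lebesgue_measure]_t complex.Re (f t))
  +i* (\int[lebesgue_measure]_t complex.Im (f t)).

Definition expi (theta : R) : R[i] := cos theta +i* sin theta.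

Definition spectral_density (V : R -> R) (omega : R) : R[i] :=
  ((2 * pi)^-1)%:C *
  complex_integral (fun tau => expi (- (omega * tau)) * (V tau)%:C).

Context {d : measure_display} {T : measurableType d} {P : probability T R}.
Implicit Types x : R -> {RV P >-> R}.

Definition process_spectral_density x : R -> R[i] :=
  spectral_density (autocovariance x).

Definition real_spectral_density x (omega : R) : R :=
  complex.Re (process_spectral_density x omega).

Definition spectral_max x : R := sup (range (real_spectral_density x)).

(* The first three clauses say that the spectral density itself makes sense:
   V is a function of the lag only, its Fourier integral converges absolutely,
   and the result is real, so that taking a maximum is meaningful. *)
Definition spectral_max_well_defined x : Prop :=
  let S := real_spectral_density x in
  [/\ weakly_stationary x,
      lebesgue_measure.-integrable setT (EFin \o autocovariance x),
      forall omega, complex.Im (process_spectral_density x omega) = 0 &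
      [/\ exists M : R, forall omega, `|S omega| <= M,
          S omega @[omega --> +oo] --> 0,
          S omega @[omega --> -oo] --> 0 &
          exists omega0, forall omega, S omega <= S omega0]].

(* |b1| and |b2| are of the same order as l tends to lstar from below. *)
Definition same_order_at_left (b1 b2 : R -> R) (lstar : R) : Prop :=
  let q := fun l => (`|b1 l / b2 l|)%:E in
  let linf := limf_einf q (at_left lstar) in
  let lsup := limf_esup q (at_left lstar) in
  [/\ (0 < linf)%E, (linf <= lsup)%E & (lsup < +oo)%E].

End spectral.

(* Main.v *)
Require Import Defs.
From HB Require Import structures.
From mathcomp Require Import all_boot all_order all_algebra.
From mathcomp Require Import all_classical all_reals all_analysis.
From mathcomp Require Import measurable_realfun ring lra.

Import Order.TTheory GRing.Theory Num.Theory.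
Import numFieldNormedType.Exports.

Local Open Scope classical_set_scope.
Local Open Scope ring_scope.

Set Implicit Arguments.
Unset Strict Implicit.
Unset Printing Implicit Defensive.

(** Write G(z) = |z|^(2H), al = - A(lambda), and let S, S' be independent
    exponential variables of rate 1.

    The proof rests on exact scaling.  Integrating by parts, the stationary
    solution is x_t = sigma E[W_t - W_(t - S / al)], the expectation bearing on S
    alone, so that the covariance of fractional Brownian motion gives

      cov(x_t, x_(t + tau)) = sigma^2 al^(-2H) v(al tau),
      v(tau) = - E[G(tau - S + S') - G(tau - S) - G(tau + S') + G(tau)] / 2,

    with v ([fou_cov]) independent of lambda and sigma.  The spectral density is
    thus w |-> (2 pi)^-1 sigma^2 al^(-1 - 2H) C(w / al), where C is the cosine
    transform of v, and the quotient of its maximum by al^(-1 - 2H) does not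
    depend on lambda.  What remains is that C is well defined, vanishes at
    infinity and has a positive maximum.

    - v is integrable and its translation modulus in L^1 tends to 0.  Both follow
      from one bound on the L^1 norm of x |-> G(x+h+s) - G(x+h) - G(x+s) + G(x)
      ([integral_incr2]).  As 2H <= 1, G is concave on the half-line, so this
      function is nonpositive off an interval of length h + s, and its integral
      telescopes.
    - By the Riemann-Lebesgue argument (a shift by pi / w changes the sign of the
      cosine), C tends to 0 at infinity ([cos_transform_vanishes]).
    - C is positive somewhere, because averaging it against the Fejer kernel
      tests v against an approximate identity, and v(0) > 0
      ([cos_transform_pos], [fou_cov0_gt0]).  Being continuous, it attains its
      maximum ([cos_transform_max]).

    The covariances are computed without any integral of the paths: for every
    square integrable Y, the scalar product of a Riemann-Stieltjes sum with Y is
    the Riemann-Stieltjes sum of the continuous function r(u) = E[W_u Y], which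
    converges to E[r(t) - r(t - S / al)] ([cvg_rs_sum]).  Taking for Y first a
    value of W and then another Wiener integral yields the covariance above
    ([ip_ou_ou]). *)

(** * Integrability of real-valued functions *)

Section integrable_real_functions.
Context {d : measure_display} {T : measurableType d} {R : realType}.
Context {mu : {measure set T -> \bar R}}.
Implicit Types f g : T -> R.

Lemma integrable_addr {f g} : mu.-integrable setT (EFin \o f) ->
  mu.-integrable setT (EFin \o g) ->
  mu.-integrable setT (EFin \o (fun x => f x + g x)).
Proof.
move=> fi gi; apply: eq_integrable (integrableD measurableT fi gi) => // x _.
Qed.

Lemma integrable_subr {f g} : mu.-integrable setT (EFin \o f) ->
  mu.-integrable setT (EFin \o g) ->
  mu.-integrable setT (EFin \o (fun x => f x - g x)).
Proof.
move=> fi gi; apply: eq_integrable (integrableB measurableT fi gi) => // x _.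
Qed.

Lemma integrable_mulr (c : R) {f} : mu.-integrable setT (EFin \o f) ->
  mu.-integrable setT (EFin \o (fun x => c * f x)).
Proof.
move=> fi; apply: eq_integrable (integrableZl measurableT c fi) => // x _.
Qed.

Lemma integrable_le_norm {f g} : measurable_fun setT f ->
  mu.-integrable setT (EFin \o g) -> (forall x, `|f x| <= g x) ->
  mu.-integrable setT (EFin \o f).
Proof.
move=> mf gi fg; apply: le_integrable gi => //; first exact/measurable_EFinP.
by move=> x _ /=; rewrite lee_fin (le_trans (fg x))// ler_norm.
Qed.

End integrable_real_functions.

(** * Powers of the absolute value with exponent at most 1 *)

Section abs_power.
Context {R : realType}.

Definition incr (h : R) (f : R -> R) (x : R) : R := f (x + h) - f x.

(** Obtained from the convexity of the power 1/p, applied at x^p and y^p. *)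
Lemma concave_powR {p x y t : R} : 0 < p <= 1 -> 0 <= x -> 0 <= y ->
  0 <= t <= 1 ->
  t * x `^ p + (1 - t) * y `^ p <= (t * x + (1 - t) * y) `^ p.
Proof.
move=> /andP[p0 p1] x0 y0 t01; have /andP[t0 t1] := t01.
have t'0 : 0 <= 1 - t by rewrite subr_ge0.
have := @convex_powR R p^-1 _ (Itv01 t0 t1) (x `^ p) (y `^ p).
rewrite convRE [X in X `^ _ <= _]convRE /= !inE /= !in_itv /= !powR_ge0.
rewrite -!powRrM divff ?gt_eqF// !powRr1// => /(_ _ isT isT).
rewrite invf_ge1// => /(_ p1) h.
have -> : t * x `^ p + (1 - t) * y `^ p
       = ((t * x `^ p + (1 - t) * y `^ p) `^ p^-1) `^ p.
  rewrite -powRrM mulVf ?gt_eqF// powRr1//.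
  by rewrite addr_ge0// mulr_ge0// powR_ge0.
apply: ge0_ler_powR h; rewrite ?nnegrE ?powR_ge0 ?(ltW p0)//.
by rewrite addr_ge0// mulr_ge0.
Qed.

Variable p : R.
Hypothesis p01 : 0 < p <= 1.

Definition absp (x : R) : R := `|x| `^ p.

Let p0 : 0 < p. Proof. by case/andP: p01. Qed.
Let p1 : p <= 1. Proof. by case/andP: p01. Qed.

Lemma absp_ge0 x : 0 <= absp x. Proof. exact: powR_ge0. Qed.

Lemma absp0 : absp 0 = 0. Proof. by rewrite /absp normr0 powR0// gt_eqF. Qed.

Lemma abspN x : absp (- x) = absp x. Proof. by rewrite /absp normrN. Qed.

Lemma abspM a x : absp (a * x) = absp a * absp x.
Proof. by rewrite /absp normrM powRM. Qed.

Lemma absp_le (x y : R) : `|x| <= `|y| -> absp x <= absp y.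
Proof. by move=> xy; apply: ge0_ler_powR; rewrite ?nnegrE// ltW. Qed.

Lemma absp_le1D x : absp x <= 1 + `|x|.
Proof.
rewrite /absp; case: (lerP 1 `|x|) => x1.
  by rewrite (le_trans (ler1_powR x1 p1))// lerDr.
have : `|x| `^ p <= 1 `^ p by apply: ge0_ler_powR; rewrite ?nnegrE// ltW.
by rewrite powR1 => /le_trans; apply; rewrite lerDl.
Qed.

(** x + h and x + s are the two convex combinations of x and x + h + s with
    weights exchanged, so the claim is concavity used twice. *)
Lemma incr2_absp_le0 {h s x : R} : 0 <= h -> 0 <= s -> 0 <= x ->
  incr h (incr s absp) x <= 0.
Proof.
move=> h0 s0 x0; rewrite /incr /absp.
have [hs|hs] := eqVneq (h + s) 0.
  have -> : s = 0 by lra.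
  have -> : h = 0 by lra.
  by rewrite !addr0; lra.
have hs0 : 0 < h + s by rewrite lt_neqAle eq_sym hs/= addr_ge0.
rewrite !ger0_norm ?addr_ge0//.
pose t := s / (h + s).
have tE : t * (h + s) = s by rewrite /t mulfVK.
have t01 : 0 <= t <= 1.
  by rewrite /t divr_ge0 ?(ltW hs0)//= ler_pdivrMr// mul1r; lra.
have t01' : 0 <= 1 - t <= 1 by lra.
have xhs0 : 0 <= x + h + s by lra.
have := concave_powR p01 x0 xhs0 t01.
have := concave_powR p01 x0 xhs0 t01'.
have -> : t * x + (1 - t) * (x + h + s) = x + h.
  by rewrite -[in RHS](addrK s h) -[X in _ + (_ - X)]tE; ring.
have -> : (1 - t) * x + (1 - (1 - t)) * (x + h + s) = x + s.
  by rewrite -[in RHS]tE; ring.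
lra.
Qed.

(** The case x = 0 of the sign of double increments. *)
Lemma absp_subadd x y : absp (x + y) <= absp x + absp y.
Proof.
have h : absp (x + y) <= absp (`|x| + `|y|).
  by apply: absp_le; rewrite [leRHS]ger0_norm ?addr_ge0// ler_normD.
apply: le_trans h _.
have := incr2_absp_le0 (normr_ge0 x) (normr_ge0 y) (lexx 0).
rewrite /incr absp0 !add0r /absp !normr_id; lra.
Qed.

Lemma absp_holder x y : `|absp x - absp y| <= absp (x - y).
Proof.
have h1 := absp_subadd (x - y) y.
have h2 := absp_subadd (y - x) x.
rewrite !subrK in h1 h2; rewrite -[y - x]opprB abspN in h2.
by rewrite ler_norml; lra.
Qed.

Lemma absp_small {e : R} : 0 < e ->
  exists2 d : R, 0 < d & forall x, `|x| <= d -> absp x <= e.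
Proof.
move=> e0; exists (e `^ p^-1); first exact: powR_gt0.
move=> x xe; have -> : e = absp (e `^ p^-1).
  by rewrite /absp ger0_norm ?powR_ge0// -powRrM mulVf ?gt_eqF// powRr1// ltW.
by apply: absp_le; rewrite (ger0_norm (powR_ge0 _ _)).
Qed.

Lemma holder_continuous {f : R -> R} {C : R} :
  (forall x y, `|f x - f y| <= C * absp (x - y)) -> continuous f.
Proof.
move=> fC x; apply/cvgrPdist_le => e e0.
have C0 : 0 < `|C| + 1 by rewrite ltr_wpDl.
have [d d0 H] := absp_small (divr_gt0 e0 C0).
near=> y; rewrite (le_trans (fC _ _))//.
have {}H : absp (x - y) <= e / (`|C| + 1).
  by apply: H; near: y; exact: cvgr_dist_le.
apply: (@le_trans _ _ ((`|C| + 1) * absp (x - y))).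
  by rewrite ler_wpM2r ?absp_ge0// (le_trans (ler_norm C))// lerDl.
by rewrite -ler_pdivlMl// mulrC.
Unshelve. all: by end_near. Qed.

Lemma continuous_absp : continuous absp.
Proof.
by apply: (@holder_continuous _ 1) => x y; rewrite mul1r absp_holder.
Qed.

(** The double increment is invariant under the reflection
    x |-> - (h + s) - x, which carries one half-line to the other. *)
Lemma incr2_absp_le0_out (h s x : R) : 0 <= h -> 0 <= s ->
  (0 <= x) || (x <= - (h + s)) -> incr h (incr s absp) x <= 0.
Proof.
move=> h0 s0 /orP[|xhs]; first exact: incr2_absp_le0.
have -> : incr h (incr s absp) x = incr h (incr s absp) (- (h + s) - x).
  have abspNE a b : a = - b -> absp a = absp b by move=> ->; rewrite abspN.
  rewrite /incr (abspNE (x + h + s) (- (h + s) - x)); last by ring.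
  rewrite (abspNE (x + h) (- (h + s) - x + s)); last by ring.
  rewrite (abspNE (x + s) (- (h + s) - x + h)); last by ring.
  rewrite (abspNE x (- (h + s) - x + h + s)); last by ring.
  lra.
by apply: incr2_absp_le0 => //; lra.
Qed.

Lemma incr_absp_le (s x : R) : `|incr s absp x| <= absp s.
Proof. by rewrite /incr (le_trans (absp_holder _ _))// addrAC subrr add0r. Qed.

Lemma incr2_absp_le (h s x : R) : `|incr h (incr s absp) x| <= 2 * absp h.
Proof.
have := incr_absp_le h (x + s); have := incr_absp_le h x.
rewrite /incr !ler_norml (addrAC x s h); lra.
Qed.

End abs_power.

(** * Affine changes of variable for the Lebesgue measure *)

Section affine_change_of_variable.
Context {R : realType}.
Notation leb := (@lebesgue_measure R).
Local Open Scope ereal_scope.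

(** The codomain is annotated so that the pushforward of the Lebesgue measure
    is again a measure on the Borel sigma-algebra generated by intervals. *)
Definition affine (a b x : R) : measurableTypeR R := (a * x + b)%R.

Lemma measurable_affine a b : measurable_fun [set: measurableTypeR R] (affine a b).
Proof.
apply: continuous_measurable_fun => x.
by apply: cvgD; [apply: cvgM; [exact: cvg_cst|exact: cvg_id]|exact: cvg_cst].
Qed.

(** By uniqueness of the Lebesgue measure, it suffices to compare both sides on
    bounded intervals; a negative slope exchanges the open and the closed end. *)
Lemma lebesgue_measure_affine (a b : R) (B : set R) : a != 0%R ->
  measurable B ->
  leb B = `|a|%:E * pushforward leb (affine a b) B.
Proof.
move=> a0 mB.
have a0' : (0 < `|a|)%R by rewrite normr_gt0.
have uniq := @lebesgue_measure_unique R
  (mscale (NngNum (ltW a0')) (pushforward leb (affine a b))).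
refine (uniq (measurable_affine a b) _ B mB) => _ [[u v]] _ <-.
transitivity (`|a|%:E * leb (affine a b @^-1` `]u, v])); last by [].
have [ap|an] : (0 < a \/ a < 0)%R.
  by case: (ltgtP a 0%R) a0 => //; [right|left].
- rewrite (_ : affine a b @^-1` _ = `](u - b) / a, (v - b) / a]%classic)%R; last first.
    apply/seteqP; split => x; rewrite /= !in_itv/= /affine;
      by rewrite ltr_pdivrMr// ler_pdivlMr// ltrBlDr lerBrDr mulrC.
  rewrite !lebesgue_measure_itv/= !lte_fin gtr0_norm//.
  rewrite ltr_pM2r ?invr_gt0// ltrD2r; case: ifPn => _; last by rewrite mule0.
  by rewrite -!EFinB -EFinM; congr (_%:E); field; rewrite gt_eqF.
- rewrite (_ : affine a b @^-1` _ = `[(v - b) / a, (u - b) / a[%classic)%R; last first.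
    apply/seteqP; split => x; rewrite /= !in_itv/= /affine andbC;
      by rewrite ltr_ndivlMr// ler_ndivrMr// ltrBlDr lerBrDr mulrC.
  rewrite !lebesgue_measure_itv/= !lte_fin ltr0_norm//.
  rewrite ltr_nM2r ?invr_lt0// ltrD2r; case: ifPn => _; last by rewrite mule0.
  by rewrite -!EFinB -EFinM; congr (_%:E); field; rewrite lt_eqF.
Qed.

Lemma ge0_integral_affine {a : R} (b : R) {f : R -> \bar R} : a != 0%R ->
  measurable_fun [set: R] f -> (forall x, 0 <= f x) ->
  \int[leb]_x f (a * x + b)%R = `|a|^-1%:E * \int[leb]_x f x.
Proof.
move=> a0 mf f0.
have a0' : (0 < `|a|)%R by rewrite normr_gt0.
have -> : \int[leb]_x f x = `|a|%:E * \int[pushforward leb (affine a b)]_x f x.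
  rewrite -(ge0_integral_mscale (pushforward leb (affine a b)) measurableT
    (NngNum (ltW a0'))) //.
    exact: measurable_affine.
  move=> maff; apply: eq_measure_integral => A mA _.
  exact: lebesgue_measure_affine.
rewrite ge0_integral_pushforward//; last exact: measurable_affine.
by rewrite muleA -EFinM mulVf ?gt_eqF// mul1e.
Qed.

Lemma integrable_affine {a : R} (b : R) {f : R -> R} : a != 0%R ->
  leb.-integrable setT (EFin \o f) ->
  leb.-integrable setT (EFin \o (fun x => f (a * x + b)%R)).
Proof.
move=> a0 /integrableP[mf intf]; apply/integrableP; split.
  apply: (@measurableT_comp _ _ _ _ _ _ (EFin \o f)) => //.
  exact: measurable_affine.
have mf' : measurable_fun [set: R] (abse \o (EFin \o f)).
  exact: measurableT_comp.
rewrite (ge0_integral_affine b a0 mf' (fun=> abse_ge0 _)).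
by rewrite lte_mul_pinfty// lee_fin invr_ge0.
Qed.

Lemma Rintegral_affine {a : R} (b : R) {f : R -> R} : a != 0%R ->
  leb.-integrable setT (EFin \o f) ->
  (\int[leb]_x f (a * x + b) = `|a|^-1 * \int[leb]_x f x)%R.
Proof.
move=> a0 intf; have mf := measurable_int leb intf.
rewrite /Rintegral integralE [in RHS]integralE.
have E1 := ge0_integral_affine b a0 (measurable_funepos mf) (funepos_ge0 _).
have E2 := ge0_integral_affine b a0 (measurable_funeneg mf) (funeneg_ge0 _).
rewrite (_ : \int[leb]_x _ = `|a|^-1%:E * \int[leb]_x (EFin \o f)^\+ x); last first.
  by rewrite -E1; apply: eq_integral => x _; rewrite !funeposE.
rewrite (_ : \int[leb]_x (fun x => (f (a * x + b)%R)%:E)^\- x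
   = `|a|^-1%:E * \int[leb]_x (EFin \o f)^\- x); last first.
  by rewrite -E2; apply: eq_integral => x _; rewrite !funenegE.
have fp : \int[leb]_x (EFin \o f)^\+ x \is a fin_num.
  by apply: integrable_pos_fin_num.
have fn : \int[leb]_x (EFin \o f)^\- x \is a fin_num.
  by apply: integrable_neg_fin_num.
by rewrite fineB ?fin_numM// [in RHS]fineB// 2?fineM//= mulrBr.
Qed.

Lemma ge0_integral_shift (b : R) {f : R -> \bar R} :
  measurable_fun [set: R] f -> (forall x, 0 <= f x) ->
  \int[leb]_x f (x + b)%R = \int[leb]_x f x.
Proof.
move=> mf f0; have := ge0_integral_affine b (oner_neq0 R) mf f0.
rewrite normr1 invr1 mul1e => <-.
by apply: eq_integral => x _; rewrite mul1r.
Qed.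

Lemma integrable_shift (b : R) {f : R -> R} :
  leb.-integrable setT (EFin \o f) ->
  leb.-integrable setT (EFin \o (fun x => f (x + b)%R)).
Proof.
move=> /(integrable_affine b (oner_neq0 R)).
by apply: eq_integrable => // x _ /=; rewrite mul1r.
Qed.

Lemma Rintegral_shift (b : R) {f : R -> R} :
  leb.-integrable setT (EFin \o f) ->
  (\int[leb]_x f (x + b) = \int[leb]_x f x)%R.
Proof.
move=> /(Rintegral_affine b (oner_neq0 R)).
rewrite normr1 invr1 mul1r => <-.
by apply: eq_Rintegral => x _; rewrite mul1r.
Qed.

End affine_change_of_variable.

(** * Integrals of increments over bounded intervals *)

Section truncation.
Context {R : realType}.
Notation leb := (@lebesgue_measure R).

Lemma ge0_integral_le_truncated (f : R -> R) (K : R) :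
  measurable_fun setT f -> (forall x, 0 <= f x) ->
  (forall n, (\int[leb]_(x in `[(- n%:R)%R, n%:R%R]) (f x)%:E <= K%:E)%E) ->
  (\int[leb]_x (f x)%:E <= K%:E)%E.
Proof.
move=> mf f0 fK.
pose F n : set R := `[(- n%:R), n%:R]%classic.
have ndF : nondecreasing_seq F.
  move=> m n mn; apply/subsetPset; apply: subset_itv; rewrite bnd_simp.
    by rewrite lerN2 ler_nat.
  by rewrite ler_nat.
have FT : \bigcup_n F n = setT by exact: bigcup_itvT.
have h := @ge0_nondecreasing_set_cvg_integral _ (measurableTypeR R) _ F (EFin \o f) leb ndF.
have mF n : measurable_fun (F n) (EFin \o f).
  by apply: measurable_funTS; exact/measurable_EFinP.
have F0 n x : F n x -> (0 <= (EFin \o f) x)%E by rewrite lee_fin.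
rewrite FT in h; have {}h := h (fun n => measurable_itv _) mF F0.
rewrite -(cvg_lim _ h)//; apply: lime_le; last by near=> n; exact: fK.
by apply/cvg_ex; eexists; exact: h.
Unshelve. all: by end_near. Qed.

Lemma integrable_indicM {f : R -> R} (a b : R) : continuous f ->
  leb.-integrable setT (EFin \o (fun x => \1_`[a, b] x * f x)).
Proof.
move=> cf.
have : leb.-integrable `[a, b] (EFin \o f).
  apply: continuous_compact_integrable; first exact: segment_compact.
  exact: continuous_subspaceT.
move/(@integrable_mkcond _ (measurableTypeR R) R leb _ (EFin \o f) (measurable_itv _)).
apply: eq_integrable => // x _ /=.
by rewrite restrict_EFin/= patch_indic/= mulrC.
Qed.

Lemma Rintegral_indic (a b : R) : a <= b -> \int[leb]_x \1_`[a, b] x = b - a.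
Proof.
move=> ab; rewrite /Rintegral integral_indic//= setIT lebesgue_measure_itv/= lte_fin.
by case: ltgtP ab => //= -> _; rewrite subrr.
Qed.

(** Telescoping: only the values of g within h of the two ends of [-N, N] survive,
    so the bound is uniform in N although g itself need not be integrable. *)
Lemma Rintegral_incr_ge (g : R -> R) (B h N : R) : continuous g ->
  (forall x, `|g x| <= B) -> 0 <= h -> 0 <= N ->
  - (\int[leb]_x (\1_`[(- N), N] x * incr h g x)) <= 2 * h * B.
Proof.
move=> cg gB h0 N0.
have B0 : 0 <= B by exact: le_trans (normr_ge0 _) (gB 0).
have i1 a b : leb.-integrable setT (EFin \o (fun x => \1_`[a, b] x * g x)).
  exact: integrable_indicM.
have i2 a b c : leb.-integrable setT (EFin \o (fun x => c * \1_`[a, b] x)).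
  have : continuous (cst c : R -> R) by move=> x; exact: cvg_cst.
  move/(integrable_indicM a b); apply: eq_integrable => // x _ /=.
  by rewrite mulrC.
(* The translated term g (x + h) is integrated over the translated interval. *)
have E : \int[leb]_x (\1_`[(- N), N] x * incr h g x) =
    \int[leb]_x (\1_`[(h - N), (N + h)] x * g x - \1_`[(- N), N] x * g x).
  rewrite RintegralB//= -(Rintegral_shift h (i1 (h - N) (N + h)))//.
  rewrite -RintegralB//; last exact: (integrable_shift h (i1 (h - N) (N + h))).
  apply: eq_Rintegral => x _; rewrite !indicE !mem_setE !in_itv/=.
  by rewrite (addrC h (- N)) !lerD2r /incr mulrBr.
have iB := integrable_subr (i1 (h - N) (N + h)) (i1 (- N) N).
rewrite E; apply: (@le_trans _ _ (\int[leb]_x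
  `|\1_`[(h - N), (N + h)] x * g x - \1_`[(- N), N] x * g x|)).
  apply: le_trans (le_normr_Rintegral measurableT iB).
  by rewrite -normrN ler_norm.
apply: (@le_trans _ _ (\int[leb]_x
  (B * \1_`[(- N), (- N + h)] x + B * \1_`[N, (N + h)] x))).
  apply: le_Rintegral => //.
  - exact: integrable_norm iB.
  - exact: integrable_addr (i2 _ _ B) (i2 _ _ B).
  - move=> x _; rewrite -mulrBl normrM.
    rewrite -mulrDr mulrC; apply: ler_pM => //.
    rewrite !indicE !mem_setE !in_itv/=.
    case: (lerP (- N) x) => /=; case: (lerP x N) => /=;
    case: (lerP (h - N) x) => /=; case: (lerP x (N + h)) => /=;
    case: (lerP x (- N + h)) => /=; case: (lerP N x) => /=;
    rewrite ?subr0 ?sub0r ?subrr ?normrN ?normr1 ?normr0 ?addr0 ?add0r;lra.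
rewrite RintegralD// !RintegralZl//=; last 2 first.
- by have := i2 N (N + h) 1; apply: eq_integrable => // x _ /=; rewrite mul1r.
- by have := i2 (- N) (- N + h) 1; apply: eq_integrable => // x _ /=; rewrite mul1r.
rewrite !Rintegral_indic; lra.
Qed.

End truncation.

(** * Integrability of the double increments of a power *)

Section second_increment.
Context {R : realType} (p : R).
Hypothesis p01 : 0 < p <= 1.
Notation leb := (@lebesgue_measure R).
Notation G := (absp p).

Lemma continuous_incr {f : R -> R} h : continuous f -> continuous (incr h f).
Proof.
move=> cf x; apply: cvgB; last exact: cf.
apply: (@continuous_comp _ _ _ (fun x : R => x + h)); last exact: cf.
by apply: cvgD; [exact: cvg_id|exact: cvg_cst].
Qed.

(** With F the double increment, |F| = - F + 2 F^+.  The integral of - F over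
    [-N, N] telescopes, while F^+ is bounded by 2 G h and supported in
    [- (h + s), 0]. *)
Lemma integral_incr2_ge0 (h s : R) : 0 <= h -> 0 <= s ->
  (\int[leb]_x (`|incr h (incr s G) x|)%:E <=
   (2 * h * G s + 4 * (h + s) * G h)%:E)%E.
Proof.
move=> h0 s0.
have cG := continuous_absp p01.
have cF : continuous (incr h (incr s G)).
  exact: continuous_incr (continuous_incr cG).
have cF' : continuous (fun x => `|incr h (incr s G) x|).
  by move=> x; apply: cvg_norm; exact: cF.
apply: ge0_integral_le_truncated => //; first exact: continuous_measurable_fun.
move=> n; pose N : R := n%:R; have N0 : 0 <= N by [].
have iF := integrable_indicM (- N) N cF.
have iF' := integrable_indicM (- N) N cF'.
have i1 : leb.-integrable setT (EFin \o (fun x => 4 * G h * \1_`[(- (h + s)), 0] x)).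
  have : continuous (cst (4 * G h) : R -> R) by move=> x; exact: cvg_cst.
  move/(integrable_indicM (- (h + s)) 0); apply: eq_integrable => // x _ /=.
  by rewrite mulrC.
have -> : (\int[leb]_(x in `[(- n%:R)%R, n%:R%R]) (`|incr h (incr s G) x|)%:E =
   (\int[leb]_x (\1_`[(- N), N] x * `|incr h (incr s G) x|))%:E)%E.
  rewrite /Rintegral fineK; last exact: integrable_fin_num.
  rewrite [LHS]integral_mkcond; apply: eq_integral => x _.
  by rewrite restrict_EFin/= patch_indic/= mulrC.
rewrite lee_fin.
apply: (@le_trans _ _ (\int[leb]_x (-1 * (\1_`[(- N), N] x * incr h (incr s G) x)
   + 4 * G h * \1_`[(- (h + s)), 0] x))).
  apply: le_Rintegral => //.
    exact: integrable_addr (integrable_mulr (-1) iF) i1.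
  move=> x _.
  have H1 := @incr2_absp_le _ _ p01 h s x.
  have H2 : ~~ ((- (h + s) <= x) && (x <= 0)) -> incr h (incr s G) x <= 0.
    rewrite negb_and -!ltNge => /orP H.
    apply: incr2_absp_le0_out => //; apply/orP.
    by case: H => /ltW ?; [right|left].
  have Gh := absp_ge0 p h.
  rewrite !indicE !mem_setE !in_itv/=.
  case: (_ && _) => /=; rewrite ?mul0r ?mulr0 ?add0r ?mul1r ?mulN1r.
    case: (_ && _) H2 => /=; rewrite ?mulr0 ?mulr1 => H2.
      have /andP[? ?] : - (2 * G h) <= incr h (incr s G) x <= 2 * G h.
        by rewrite -ler_norml.
      by have [?|?] := lerP 0 (incr h (incr s G) x); lra.
    by rewrite ler0_norm ?addr0// H2.
  by rewrite mulr_ge0// mulr_ge0.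
rewrite RintegralD//; last exact: (integrable_mulr (-1) iF).
rewrite (RintegralZl (-1) measurableT iF) mulN1r RintegralZl//=; last first.
  have : continuous (cst 1 : R -> R) by move=> x; exact: cvg_cst.
  move/(integrable_indicM (- (h + s)) 0); apply: eq_integrable => // x _ /=.
  by rewrite mulr1.
rewrite Rintegral_indic; last by rewrite oppr_le0 addr_ge0.
apply: lerD; last by rewrite sub0r opprK mulrAC.
apply: Rintegral_incr_ge => //; first exact: continuous_incr.
by move=> x; exact: incr_absp_le.
Qed.

Lemma incrC (h s : R) (f : R -> R) x : incr h (incr s f) x = incr s (incr h f) x.
Proof. by rewrite /incr (addrAC x s h); lra. Qed.

(** A negative step is a positive one taken from a translated point, up to
    sign; hence the translation by c. *)
Lemma integral_incr2 (h s : R) :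
  (\int[leb]_x (`|incr h (incr s G) x|)%:E <=
   (2 * `|h| * G s + 4 * (`|h| + `|s|) * G h)%:E)%E.
Proof.
pose c := Num.min h 0 + Num.min s 0.
have Gn x : G x = G `|x| by rewrite /absp normr_id.
have E x : `|incr h (incr s G) x| = `|incr `|h| (incr `|s| G) (x + c)|.
  rewrite /c /incr; have [h0|h0] := lerP h 0; have [s0|s0] := lerP s 0;
  rewrite ?(ler0_norm h0) ?(gtr0_norm h0) ?(ler0_norm s0) ?(gtr0_norm s0).
  - rewrite (_ : x + (h + s) + - h + - s = x); last ring.
    rewrite (_ : x + (h + s) + - h = x + s); last ring.
    rewrite (_ : x + (h + s) + - s = x + h); last ring.
    rewrite (_ : x + (h + s) = x + h + s); last ring.
    congr `|_|; ring.
  - rewrite addr0 (_ : x + h + - h + s = x + s); last ring.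
    rewrite (_ : x + h + - h = x); last ring.
    rewrite -normrN; congr `|_|; ring.
  - rewrite add0r (_ : x + s + h + - s = x + h); last ring.
    rewrite (_ : x + s + - s = x); last ring.
    rewrite (_ : x + s + h = x + h + s); last ring.
    rewrite -normrN; congr `|_|; ring.
  - by rewrite !addr0.
under eq_integral do rewrite E.
have cG := continuous_absp p01.
have cF : continuous (incr `|h| (incr `|s| G)).
  exact: continuous_incr (continuous_incr cG).
rewrite (ge0_integral_shift c (f := fun x => (`|incr `|h| (incr `|s| G) x|)%:E)).
- by rewrite (Gn h) (Gn s) integral_incr2_ge0.
- apply/measurable_EFinP; apply: measurableT_comp => //.
  exact: continuous_measurable_fun.
- by move=> x; rewrite lee_fin.
Qed.

(** The product form of this bound makes it integrable when h and s are
    independent exponential variables.  Exchanging h and s, the smaller of the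
    two steps may be put in front. *)
Lemma integral_incr2_sym (h s : R) :
  (\int[leb]_x (`|incr h (incr s G) x|)%:E <=
   (10 * (1 + `|h|) * (1 + `|s|))%:E)%E.
Proof.
wlog hs : h s / `|h| <= `|s|.
  move=> H; have [|/ltW sh] := lerP `|h| `|s|; first exact: H.
  under eq_integral do rewrite incrC.
  by rewrite (le_trans (H _ _ sh))// lee_fin mulrAC.
apply: le_trans (integral_incr2 h s) _; rewrite lee_fin.
have Gh := absp_le1D p01 h; have Gs := absp_le1D p01 s.
have h0 := normr_ge0 h; have s0 := normr_ge0 s.
have H1 : `|h| * G s <= `|h| * (1 + `|s|) by rewrite ler_wpM2l.
have H2 : (`|h| + `|s|) * G h <= (2 * `|s|) * (1 + `|h|).
  by rewrite ler_pM ?absp_ge0 ?addr_ge0//; lra.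
have H3 : 0 <= `|h| * `|s| by rewrite mulr_ge0.
rewrite -!mulrA; nra.
Qed.

End second_increment.

(** * The standard exponential distribution *)

Section standard_exponential.
Context {R : realType}.

Notation leb := (@lebesgue_measure R).

Definition expo : probability (measurableTypeR R) R.
Proof. by refine (exponential_prob 1); exact: ltr01. Defined.

Let FTC_ray (x : R) : 0 <= x ->
  (\int[leb]_(u in `[x, +oo[) (expR (- u))%:E = (expR (- x))%:E)%E.
Proof.
move=> x0.
have c : continuous (fun u : R => expR (- u)).
  move=> u; apply: continuous_comp; last exact: continuous_expR.
  exact: cvgN.
rewrite (@ge0_continuous_FTC2y _ _ (fun u => - expR (- u)) x 0).
- by rewrite EFinN oppeK add0e.
- by move=> u _; exact: expR_ge0.
- exact: continuous_subspaceT.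
- by rewrite -oppr0; apply: cvgN; exact: cvgr_expR.
- by move=> u _; exact: ex_derive.
- by apply: cvgN; apply/cvg_at_right_filter; exact: c.
- by move=> u _; rewrite derive1E derive_val; rewrite /GRing.scale/=; ring.
Qed.

Lemma expo_ray (x : R) : 0 <= x -> expo `[x, +oo[%classic = (expR (- x))%:E.
Proof.
move=> x0; rewrite -FTC_ray// /expo/= /exponential_prob.
apply: eq_integral => u; rewrite inE/= in_itv/= andbT => xu.
by rewrite exponential_pdfE ?(le_trans x0)// mul1r mulN1r.
Qed.

Lemma expo_neg : expo `]-oo, (0:R)[%classic = 0%E.
Proof.
rewrite /expo/= /exponential_prob integral0_eq// => x; rewrite /= in_itv/= => x0.
by rewrite lt0_exponential_pdf.
Qed.

Lemma integral_expo_cst (k : R) : (\int[expo]_s k%:E = k%:E)%E.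
Proof.
rewrite integral_cst//; transitivity (k%:E * 1%:E)%E; last exact: mule1.
by congr (_ * _)%E; exact: (probability_setT expo).
Qed.

(** The mean of |s| is the integral of the tail function. *)
Lemma integrable_expo_affine : expo.-integrable setT (EFin \o (fun s : R => 1 + `|s|)).
Proof.
have mX : measurable_fun [set: measurableTypeR R] (fun s : R => `|s|).
  exact: continuous_measurable_fun (@norm_continuous _ R^o).
pose X : {RV expo >-> R} :=
  HB.pack (fun s : measurableTypeR R => `|s| : R) (isMeasurableFun.Build _ _ _ _ _ mX).
have X0 x : 0 <= X x by exact: normr_ge0.
have EX : (\int[expo]_s (`|s|)%:E <= 1%:E)%E.
  have := ge0_expectation_ccdf X0; rewrite unlock => ->.
  have <- : (\int[leb]_(u in `[0%R, +oo[) (expR (- u))%:E = 1%:E)%E.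
    by rewrite FTC_ray// oppr0 expR0.
  apply: ge0_le_integral => //.
  - apply: measurable_funTS; exact: ccdf_measurable.
  - apply/measurable_EFinP; apply: measurable_funTS.
    apply: continuous_measurable_fun => u.
    by apply: continuous_comp; [exact: cvgN|exact: continuous_expR].
  - move=> r; rewrite /= in_itv/= andbT => r0.
    rewrite -expo_ray//= -[leRHS]adde0 -expo_neg.
    apply: le_trans (measureU2 _ _ _) => //.
    rewrite /ccdf /distribution /pushforward.
    apply: le_measure; rewrite ?inE//.
    + exact: (measurable_funPTI X).
    + exact: measurableU.
    + move=> s /=; rewrite !in_itv/= !andbT => rs.
      by have [s0|s0] := ltP s 0; [right|left; move: rs; rewrite ger0_norm// => /ltW].
apply: integrable_addr; first exact: finite_measure_integrable_cst.
apply/integrableP; split; first exact/measurable_EFinP.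
under eq_integral do rewrite /= normr_id.
by rewrite (le_lt_trans EX)// ltry.
Qed.

Lemma expo_integral_itv (f : R -> R) :
  expo.-integrable setT (EFin \o f) ->
  \int[expo]_s f s = \int[expo]_(s in `[0, +oo[) f s.
Proof.
move=> fi.
have := @negligible_integral _ (measurableTypeR R) R expo setT `]-oo, (0:R)[%classic
  (EFin \o f) (measurable_itv _) measurableT fi expo_neg.
by rewrite setTD setCitvl /Rintegral /= => ->.
Qed.

End standard_exponential.

(** * Increments averaged over an exponential step *)

Section exponential_mean_increment.
Context {R : realType} (p : R).
Hypothesis p01 : 0 < p <= 1.
Notation leb := (@lebesgue_measure R).
Notation G := (absp p).

(** The factor c is 1 or -1 in what follows: the sign of the step. *)
Definition mean_incr (c : R) (f : R -> R) (x : R) : R :=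
  \int[expo]_s incr (c * s) f x.

Definition absp_holder_with (C : R) (f : R -> R) : Prop :=
  forall x y, `|f x - f y| <= C * G (x - y).

Notation m1 := (\int[@expo R]_s (1 + `|s|)).

Lemma expo_Rintegral_cst (k : R) : \int[@expo R]_s k = k.
Proof. by rewrite /Rintegral integral_expo_cst. Qed.

Lemma holder_ge0 C f : absp_holder_with C f -> 0 <= C.
Proof.
move=> fC; have := fC 1 0; rewrite subr0 /absp normr1 powR1 mulr1.
exact: le_trans.
Qed.

Lemma measurable_incr (c x : R) f : continuous f ->
  measurable_fun setT (fun s : R => incr (c * s) f x).
Proof.
move=> cf; apply: continuous_measurable_fun => s.
apply: cvgB; last exact: cvg_cst.
apply: (@continuous_comp _ _ _ (fun s : R => x + c * s)); last exact: cf.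
by apply: cvgD; [exact: cvg_cst|apply: cvgM; [exact: cvg_cst|exact: cvg_id]].
Qed.

Lemma measurable_incr2 (c : R) f : continuous f ->
  measurable_fun setT (fun z : measurableTypeR R * measurableTypeR R => incr (c * z.2) f z.1).
Proof.
move=> cf; have mf := continuous_measurable_fun cf.
apply: measurable_funB; last exact: measurableT_comp.
apply: measurableT_comp => //; apply: measurable_funD => //.
by apply: measurable_funM.
Qed.

Lemma measurable_integral_incr (c : R) f : continuous f ->
  measurable_fun setT (fun s : R => (\int[leb]_x (`|incr (c * s) f x|)%:E)%E).
Proof.
move=> cf; pose F (z : measurableTypeR R * measurableTypeR R) :=
  (`|incr (c * z.2) f z.1|)%:E.
have mF : measurable_fun setT F.
  by apply/measurable_EFinP; apply: measurableT_comp => //; exact: measurable_incr2.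
have F0 z : (0 <= F z)%E by rewrite lee_fin.
exact: (@measurable_fun_fubini_tonelli_G _ _ _ _ _ leb F mF F0).
Qed.

Lemma integrable_incr (c x C : R) f : `|c| = 1 -> absp_holder_with C f ->
  expo.-integrable setT (EFin \o (fun s : R => incr (c * s) f x)).
Proof.
move=> c1 fC.
apply: (integrable_le_norm _ (integrable_mulr C (@integrable_expo_affine R))).
- exact: measurable_incr (holder_continuous p01 fC).
- move=> s; rewrite /incr (le_trans (fC _ _))//.
  rewrite ler_wpM2l ?(holder_ge0 fC)// addrAC subrr add0r.
  by rewrite (le_trans (absp_le1D p01 _))// normrM c1 mul1r.
Qed.

Lemma holder_mean_incr (c C : R) f : `|c| = 1 -> absp_holder_with C f ->
  absp_holder_with (2 * C) (mean_incr c f).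
Proof.
move=> c1 fC x y; rewrite /mean_incr.
have ix := integrable_incr x c1 fC; have iy := integrable_incr y c1 fC.
rewrite -RintegralB//; apply: le_trans (le_normr_Rintegral measurableT _) _.
  exact: integrable_subr ix iy.
rewrite -[leRHS]expo_Rintegral_cst; apply: le_Rintegral => //.
- exact: integrable_norm (integrable_subr ix iy).
- exact: finite_measure_integrable_cst.
- move=> s _; rewrite /incr.
  have -> : f (x + c * s) - f x - (f (y + c * s) - f y)
     = (f (x + c * s) - f (y + c * s)) - (f x - f y) by ring.
  rewrite (le_trans (ler_normB _ _))//.
  have h1 := fC (x + c * s) (y + c * s); have h2 := fC x y.
  have e : x + c * s - (y + c * s) = x - y by ring.
  by rewrite e in h1; lra.
Qed.

Lemma holder_incr (h C : R) f : absp_holder_with C f ->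
  absp_holder_with (2 * C) (incr h f).
Proof.
move=> fC x y; rewrite /incr.
have -> : f (x + h) - f x - (f (y + h) - f y)
     = (f (x + h) - f (y + h)) - (f x - f y) by ring.
rewrite (le_trans (ler_normB _ _))//.
have h1 := fC (x + h) (y + h); have h2 := fC x y.
have e : x + h - (y + h) = x - y by ring.
by rewrite e in h1; lra.
Qed.

Lemma incr_mean_incr (c C h x : R) f : `|c| = 1 -> absp_holder_with C f ->
  incr h (mean_incr c f) x = mean_incr c (incr h f) x.
Proof.
move=> c1 fC; rewrite /mean_incr {1}/incr.
rewrite -(RintegralB measurableT (integrable_incr _ c1 fC) (integrable_incr _ c1 fC)).
by apply: eq_Rintegral => s _; rewrite incrC.
Qed.

(** Minkowski's inequality for integrals, by exchanging the two integrations. *)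
Lemma integral_mean_incr_le (c C : R) f : `|c| = 1 -> absp_holder_with C f ->
  (\int[leb]_x (`|mean_incr c f x|)%:E <=
   \int[expo]_s \int[leb]_x (`|incr (c * s) f x|)%:E)%E.
Proof.
move=> c1 fC; have cf := holder_continuous p01 fC.
pose F (z : measurableTypeR R * measurableTypeR R) := (`|incr (c * z.2) f z.1|)%:E.
have mF : measurable_fun setT F.
  by apply/measurable_EFinP; apply: measurableT_comp => //; exact: measurable_incr2.
have F0 z : (0 <= F z)%E by rewrite lee_fin.
rewrite -(@fubini_tonelli _ _ _ _ _ leb expo F mF F0).
apply: ge0_le_integral => //.
- apply/measurable_EFinP; apply: measurableT_comp => //.
  apply: continuous_measurable_fun.
  exact: holder_continuous (holder_mean_incr c1 fC).
- exact: (@measurable_fun_fubini_tonelli_F _ _ _ _ _ expo F mF F0).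
- move=> x _; have i := integrable_incr x c1 fC.
  rewrite EFin_normr_Rintegral//.
  exact: le_abse_integral (measurable_int _ i).
Qed.

End exponential_mean_increment.

(** * The covariance function at unit rate *)

Section ou_covariance.
Context {R : realType} (p : R).
Hypothesis p01 : 0 < p <= 1.
Notation leb := (@lebesgue_measure R).
Notation G := (absp p).
Notation m1 := (\int[@expo R]_s (1 + `|s|)).

Definition mean_incr_absp : R -> R := mean_incr 1 G.

(** The covariance of the stationary solution for A = - 1 and sigma = 1.  Unfolded,
    it is - 1/2 times the mean of the double increment of |.|^p with the two
    independent exponential steps 1 * S' and -1 * S. *)
Definition fou_cov (t : R) : R := - 2^-1 * mean_incr (-1) mean_incr_absp t.

Let one1 : `|1 : R| = 1. Proof. exact: normr1. Qed.
Let oneN : `|-1 : R| = 1. Proof. exact: normrN1. Qed.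

Let holderG : absp_holder_with p 1 G.
Proof. by move=> x y; rewrite mul1r absp_holder. Qed.

Lemma holder_mean_incr_absp : absp_holder_with p (2 * 1) mean_incr_absp.
Proof. exact: holder_mean_incr. Qed.

Lemma continuous_fou_cov : continuous fou_cov.
Proof.
move=> x; apply: cvgM; first exact: cvg_cst.
exact: holder_continuous (holder_mean_incr p01 oneN holder_mean_incr_absp) _.
Qed.

Let m1_ge0 : 0 <= m1.
Proof. by apply: Rintegral_ge0 => s _; rewrite addr_ge0. Qed.

Let expo_integral_affine (k : R) : 0 <= k ->
  (\int[@expo R]_s (k * (1 + `|s|))%:E = (k * m1)%:E)%E.
Proof.
move=> k0; rewrite -RintegralZl//; last exact: integrable_expo_affine.
rewrite /Rintegral fineK//.
exact: integrable_fin_num (integrable_mulr k (@integrable_expo_affine R)).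
Qed.

(** An affine bound in the step is enough because the exponential law has a
    finite mean. *)
Let integral_mean_incr_le_affine c C K f : `|c| = 1 -> absp_holder_with p C f ->
  0 <= K ->
  (forall s, (\int[leb]_x (`|incr (c * s) f x|)%:E <= (K * (1 + `|s|))%:E)%E) ->
  (\int[leb]_x (`|mean_incr c f x|)%:E <= (K * m1)%:E)%E.
Proof.
move=> c1 fC K0 H; apply: le_trans (integral_mean_incr_le p01 c1 fC) _.
rewrite -expo_integral_affine//; apply: ge0_le_integral => //.
- by move=> s _; apply: integral_ge0 => x _; rewrite lee_fin.
- exact: measurable_integral_incr (holder_continuous p01 fC).
- exact: measurable_int (integrable_mulr K (@integrable_expo_affine R)).
Qed.

(** What remains of the bound of [integral_incr2] when its dependence on s is
    bounded by a multiple of 1 + |s| and averaged. *)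
Definition incr_modulus (h : R) : R := m1 * (2 * `|h| + 4 * (1 + `|h|) * G h).

Lemma integral_incr_mean_incr_absp (h : R) :
  (\int[leb]_x (`|incr h mean_incr_absp x|)%:E <= (incr_modulus h)%:E)%E.
Proof.
under eq_integral do rewrite (incr_mean_incr p01 _ _ one1 holderG).
rewrite /incr_modulus mulrC.
apply: (integral_mean_incr_le_affine one1 (holder_incr h holderG)).
  by rewrite addr_ge0// ?mulr_ge0 ?addr_ge0 ?absp_ge0.
move=> s; under eq_integral do rewrite mul1r incrC.
apply: le_trans (integral_incr2 p01 h s) _; rewrite lee_fin.
have Gh := absp_ge0 p h; have Gs := absp_le1D p01 s.
have h0 := normr_ge0 h; have s0 := normr_ge0 s.
have H1 : `|h| * G s <= `|h| * (1 + `|s|) by rewrite ler_wpM2l.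
have H2 : (`|h| + `|s|) * G h <= (1 + `|h|) * (1 + `|s|) * G h.
  rewrite ler_wpM2r//; have : 0 <= `|h| * `|s| by rewrite mulr_ge0.
  lra.
lra.
Qed.

Lemma integral_incr_mean_incr_absp_affine (h : R) :
  (\int[leb]_x (`|incr h mean_incr_absp x|)%:E <= (10 * m1 * (1 + `|h|))%:E)%E.
Proof.
under eq_integral do rewrite (incr_mean_incr p01 _ _ one1 holderG).
rewrite mulrAC.
apply: (integral_mean_incr_le_affine one1 (holder_incr h holderG)).
  by rewrite mulr_ge0// addr_ge0.
move=> s; under eq_integral do rewrite mul1r incrC.
exact: integral_incr2_sym.
Qed.

(** The two successive averages each cost one factor of the bound
    [integral_incr2_sym], which is a product of affine functions of the steps. *)
Lemma integrable_fou_cov : leb.-integrable setT (EFin \o fou_cov).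
Proof.
apply: integrable_mulr; apply/integrableP; split.
  apply/measurable_EFinP; apply: continuous_measurable_fun.
  exact: holder_continuous (holder_mean_incr p01 oneN holder_mean_incr_absp).
apply: le_lt_trans (ltry (10 * m1 * m1)).
apply: (integral_mean_incr_le_affine oneN holder_mean_incr_absp).
  by rewrite mulr_ge0.
move=> s; apply: le_trans (integral_incr_mean_incr_absp_affine _) _.
by rewrite mulN1r normrN.
Qed.

Let integral_incr_le2 (s : R) (f : R -> R) : continuous f ->
  (\int[leb]_x (`|incr s f x|)%:E <= 2%:E * \int[leb]_x (`|f x|)%:E)%E.
Proof.
move=> cf.
have mf : measurable_fun [set: R] (fun x => (`|f x|)%:E).
  apply/measurable_EFinP; apply: measurableT_comp => //.
  exact: continuous_measurable_fun.
have mfs : measurable_fun [set: R] (fun x => (`|f (x + s)|)%:E).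
  apply/measurable_EFinP; apply: measurableT_comp => //.
  apply: continuous_measurable_fun => x.
  apply: (@continuous_comp _ _ _ (fun x : R => x + s)); last exact: cf.
  by apply: cvgD; [exact: cvg_id|exact: cvg_cst].
have -> : (2%:E * \int[leb]_x (`|f x|)%:E =
           \int[leb]_x ((`|f (x + s)|)%:E + (`|f x|)%:E))%E.
  rewrite ge0_integralD//.
  rewrite (ge0_integral_shift s mf (fun x => normr_ge0 (f x))).
  by rewrite -[2%R]/(1 + 1)%R EFinD ge0_muleDl// !mul1e.
apply: ge0_le_integral => //.
- apply/measurable_EFinP; apply: measurableT_comp => //.
  by apply: continuous_measurable_fun; exact: continuous_incr.
- exact: emeasurable_funD.
- by move=> x _; rewrite -EFinD lee_fin ler_normB.
Qed.

(** The outer average costs a factor 2, which the factor 1/2 in [fou_cov]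
    compensates. *)
Lemma integral_incr_fou_cov (h : R) :
  (\int[leb]_x (`|incr h fou_cov x|)%:E <= (incr_modulus h)%:E)%E.
Proof.
have E x : incr h fou_cov x = - 2^-1 * mean_incr (-1) (incr h mean_incr_absp) x.
  by rewrite -(incr_mean_incr p01 _ _ oneN holder_mean_incr_absp) /incr /fou_cov mulrBr.
have hU := holder_incr h holder_mean_incr_absp.
have -> : (\int[leb]_x (`|incr h fou_cov x|)%:E =
   2^-1%:E * \int[leb]_x (`|mean_incr (-1) (incr h mean_incr_absp) x|)%:E)%E.
  rewrite -ge0_integralZl//.
  - apply: eq_integral => x _.
    have n2 : `|- 2^-1 : R| = 2^-1 by rewrite normrN ger0_norm.
    by rewrite E normrM n2.
  - apply/measurable_EFinP; apply: measurableT_comp => //.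
    apply: continuous_measurable_fun.
    exact: holder_continuous (holder_mean_incr p01 oneN hU).
have M0 : 0 <= incr_modulus h.
  by rewrite mulr_ge0// addr_ge0// ?mulr_ge0 ?addr_ge0 ?absp_ge0.
apply: (@le_trans _ _ (2^-1%:E * (2 * incr_modulus h)%:E)%E); last first.
  by rewrite -EFinM lee_fin mulKf.
apply: lee_wpmul2l; first by rewrite lee_fin.
apply: le_trans (integral_mean_incr_le p01 oneN hU) _.
apply: (@le_trans _ _ (\int[@expo R]_s (2 * incr_modulus h)%:E)%E).
  apply: ge0_le_integral => //.
  - by move=> s _; apply: integral_ge0 => x _; rewrite lee_fin.
  - exact: measurable_integral_incr (holder_continuous p01 hU).
  - move=> s _; apply: le_trans (integral_incr_le2 _ (holder_continuous p01 hU)) _.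
    by rewrite EFinM; apply: lee_wpmul2l => //; exact: integral_incr_mean_incr_absp.
by rewrite integral_expo_cst.
Qed.

Lemma incr_modulus_small (e : R) : 0 < e ->
  exists2 d : R, 0 < d & forall h, `|h| <= d -> incr_modulus h <= e.
Proof.
move=> e0.
have k0 : 0 < m1 + 1 by rewrite ltr_wpDl.
have e1 : 0 < e / (m1 + 1) / 10 by rewrite !divr_gt0.
have [d d0 dG] := absp_small p01 e1.
exists (Num.min 1 (Num.min d (e / (m1 + 1) / 10))).
  by rewrite !lt_min d0 e1 ltr01.
move=> h; rewrite !le_min => /and3P[h1 hd he]; have Gh := dG _ hd.
have Gh0 := absp_ge0 p h; have h0 := normr_ge0 h.
apply: (@le_trans _ _ (m1 * (e / (m1 + 1)))).
  rewrite ler_wpM2l//.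
  have : (1 + `|h|) * G h <= 2 * (e / (m1 + 1) / 10).
    by rewrite ler_pM ?addr_ge0//; lra.
  lra.
by rewrite mulrCA ger_pMr// ler_pdivrMr// mul1r lerDl.
Qed.

Lemma fou_cov_shift (e : R) : 0 < e -> exists2 d : R, 0 < d &
  forall h, `|h| <= d -> (\int[leb]_x (`|incr h fou_cov x|)%:E <= e%:E)%E.
Proof.
move=> e0; have [d d0 dh] := incr_modulus_small e0.
exists d => // h /dh hh; apply: le_trans (integral_incr_fou_cov h) _.
by rewrite lee_fin.
Qed.

(** At 0 the integrand is G u + G s - G (u - s), nonnegative by subadditivity,
    and at least min (G u) (G s) >= 1 when both steps are at least 1, an event of
    probability exp (-1) ^ 2. *)
Lemma fou_cov0_gt0 : 0 < fou_cov 0.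
Proof.
pose k s := mean_incr_absp 0 - mean_incr_absp (- s).
have ik s : k s = \int[@expo R]_u (G u + G s - G (u - s)).
  rewrite /k /mean_incr_absp /mean_incr.
  rewrite -(RintegralB measurableT (integrable_incr p01 _ one1 holderG)
            (integrable_incr p01 _ one1 holderG)).
  apply: eq_Rintegral => u _; rewrite /incr mul1r add0r (absp0 p01) (abspN p).
  by rewrite (addrC (- s)); ring.
have iI s : (@expo R).-integrable setT (EFin \o (fun u => G u + G s - G (u - s))).
  have := integrable_subr (integrable_incr p01 0 one1 holderG)
    (integrable_incr p01 (- s) one1 holderG).
  apply: eq_integrable => // u _ /=; congr (_%:E).
  rewrite /incr mul1r add0r (absp0 p01) (abspN p) (addrC (- s)); ring.
have k0 s : 0 <= k s.
  rewrite ik; apply: Rintegral_ge0 => u _.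
  have := absp_subadd p01 u (- s); rewrite abspN; lra.
pose J : R -> R := \1_`[1, +oo[.
have iJ : (@expo R).-integrable setT (EFin \o J).
  exact: integrable_indic.
have EJ : \int[@expo R]_u J u = expR (-1).
  rewrite /Rintegral integral_indic// setIT.
  exact: (f_equal fine (expo_ray (@ler01 R))).
have k1 s : 1 <= s -> expR (-1) <= k s.
  move=> s1; rewrite ik -EJ; apply: le_Rintegral => // u _.
  have := absp_subadd p01 u (- s); rewrite abspN => H.
  rewrite /J indicE mem_setE in_itv/= andbT; case: (lerP 1 u) => u1 /=; last lra.
  have Gge1 x : 1 <= x -> 1 <= G x.
    move=> x1; rewrite /absp ger0_norm ?(le_trans ler01)//.
    apply: (@le_trans _ _ (1 `^ p)); first by rewrite powR1.
    by case/andP: p01 => /ltW p0 _; rewrite ge0_ler_powR ?nnegrE//; lra.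
  have : G (u - s) <= Num.max (G u) (G s).
    have [us|us] := lerP u s.
      rewrite le_max; apply/orP; right; apply: (absp_le p01).
      by rewrite ler_norml !ger0_norm; lra.
    rewrite le_max; apply/orP; left; apply: (absp_le p01).
    by rewrite ler_norml !ger0_norm; lra.
  have := Gge1 _ s1; have := Gge1 _ u1; rewrite le_max => ? ? /orP[]; lra.
have -> : fou_cov 0 = 2^-1 * \int[@expo R]_s k s.
  rewrite /fou_cov mulNr -mulrN; congr (_ * _).
  have i := integrable_incr p01 0 oneN holder_mean_incr_absp.
  rewrite -mulN1r -RintegralZl//.
  by apply: eq_Rintegral => s _; rewrite /incr /k (mulN1r s) add0r; ring.
rewrite mulr_gt0//; apply: (@lt_le_trans _ _ (expR (-1) * expR (-1))).
  by rewrite mulr_gt0// expR_gt0.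
rewrite -{2}EJ -RintegralZl//; apply: le_Rintegral => //.
- exact: integrable_mulr iJ.
- have := integrable_mulr (-1) (integrable_incr p01 0 oneN holder_mean_incr_absp).
  by apply: eq_integrable => // s _ /=; congr (_%:E); rewrite /incr /k (mulN1r s) add0r; ring.
- move=> s _; rewrite /J indicE mem_setE in_itv/= andbT.
  by case: (lerP 1 s) => s1 /=; rewrite ?mulr1 ?mulr0// k1.
Qed.

End ou_covariance.

(** * The Fejer kernel *)

Section fejer_kernel.
Context {R : realType}.
Notation leb := (@lebesgue_measure R).

(** Twice the right half of the triangle function: its cosine transform is the
    Fejer kernel, which is nonnegative and integrable. *)
Definition tent (s : R) : R := \1_`[0, 1] s * (2 * (1 - s)).

Definition fejer (y : R) : R := \int[leb]_s (tent s * cos (s * y)).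

Let cont_tent_cos (y : R) : continuous (fun s : R => 2 * (1 - s) * cos (s * y)).
Proof.
move=> s; apply: cvgM.
  apply: cvgM; first exact: cvg_cst.
  by apply: cvgB; [exact: cvg_cst|exact: cvg_id].
apply: (@continuous_comp _ _ _ (fun s : R => s * y)); last exact: continuous_cos.
by apply: cvgM; [exact: cvg_id|exact: cvg_cst].
Qed.

Lemma integrable_tent_cos (y : R) :
  leb.-integrable setT (EFin \o (fun s => tent s * cos (s * y))).
Proof.
have := integrable_indicM 0 1 (@cont_tent_cos y).
by apply: eq_integrable => // s _ /=; rewrite /tent mulrA.
Qed.

Lemma tent_ge0 (s : R) : 0 <= tent s.
Proof.
rewrite /tent indicE mem_setE in_itv/=.
by case: andP => [[s0 s1]|_] /=; rewrite ?mul0r// mul1r mulr_ge0// subr_ge0.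
Qed.

Lemma tent_le (s : R) : tent s <= 2 * \1_`[0, 1] s.
Proof.
rewrite /tent indicE mem_setE in_itv/=.
by case: andP => [[s0 s1]|_] /=; rewrite ?mul0r ?mulr0//; lra.
Qed.

Let fejerE (y : R) : fejer y =
  fine (\int[leb]_(s in `[0%R, 1%R]) (2 * (1 - s) * cos (s * y))%:E)%E.
Proof.
rewrite /fejer /Rintegral; congr fine.
rewrite [RHS]integral_mkcond; apply: eq_integral => s _.
by rewrite restrict_EFin/= patch_indic/= /tent; congr (_%:E); ring.
Qed.

Let FTC_segment (f F : R -> R) (a b : R) : a < b -> continuous f ->
  (forall s : R, is_derive s (1 : R) F (f s)) ->
  fine (\int[leb]_(s in `[a, b]) (f s)%:E)%E = F b - F a.
Proof.
move=> ab cf dF; have cF : continuous F.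
  by move=> s; apply/differentiable_continuous/derivable1_diffP; case: (dF s).
rewrite (@continuous_FTC2 _ _ F a b)//.
- exact: continuous_subspaceT.
- split.
  + by move=> s _; case: (dF s).
  + exact/cvg_at_right_filter/cF.
  + exact/cvg_at_left_filter/cF.
- by move=> s _; rewrite derive1E; case: (dF s).
Qed.

Lemma fejer_formula (y : R) : y != 0 -> fejer y = 2 * (1 - cos y) / y ^+ 2.
Proof.
move=> y0; rewrite fejerE.
(* The antiderivative comes from integrating 2 (1 - s) cos (s y) by parts. *)
have dF (s : R) : is_derive s (1 : R)
    (fun s : R => 2 * ((1 - s) * (sin (s * y) / y) - cos (s * y) / y ^+ 2))
    (2 * (1 - s) * cos (s * y)).
  have dl : is_derive s (1 : R) (fun s : R => s * y) y.
    by apply: is_derive_eq; rewrite /GRing.scale/=; ring.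
  have ds : is_derive s (1 : R) (fun s : R => sin (s * y)) (cos (s * y) * y).
    exact: (@is_derive1_comp _ (@sin R) (fun s : R => s * y)).
  have dc : is_derive s (1 : R) (fun s : R => cos (s * y)) (- sin (s * y) * y).
    exact: (@is_derive1_comp _ (@cos R) (fun s : R => s * y)).
  apply: is_derive_eq; rewrite /GRing.scale/=.
  by field.
rewrite (FTC_segment ltr01 (@cont_tent_cos y) dF).
by rewrite subrr !mul0r mul1r sin0 cos0 mul1r; field.
Qed.

Lemma fejer0 : fejer 0 = 1.
Proof.
rewrite fejerE.
have dF (s : R) : is_derive s (1 : R) (fun s : R => 2 * s - s ^+ 2)
    (2 * (1 - s) * cos (s * 0)).
  apply: is_derive_eq; rewrite /GRing.scale/= mulr0 cos0. ring.
rewrite (FTC_segment ltr01 (@cont_tent_cos 0) dF).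
by rewrite expr1n; ring.
Qed.

Lemma fejer_ge0 (y : R) : 0 <= fejer y.
Proof.
have [->|y0] := eqVneq y 0; first by rewrite fejer0.
by rewrite fejer_formula// divr_ge0 ?sqr_ge0// mulr_ge0// subr_ge0 cos_le1.
Qed.

Lemma fejer_le (y : R) : y != 0 -> fejer y <= 4 / y ^+ 2.
Proof.
move=> y0; rewrite fejer_formula// ler_wpM2r ?invr_ge0 ?sqr_ge0//.
have := cos_geN1 y; lra.
Qed.

Lemma fejer_le1 (y : R) : fejer y <= 1.
Proof.
rewrite -fejer0; apply: le_Rintegral => //.
- exact: integrable_tent_cos.
- exact: integrable_tent_cos.
- by move=> s _; rewrite mulr0 cos0 ler_wpM2l ?tent_ge0 ?cos_le1.
Qed.

(** For s in [0, 1], cos (s y) >= cos 1 > 0, and the weight has total mass 1. *)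
Lemma fejer_ge (y : R) : `|y| <= 1 -> cos 1 <= fejer y.
Proof.
move=> y1; apply: (@le_trans _ _ (cos 1 * fejer 0)); first by rewrite fejer0 mulr1.
rewrite /fejer -RintegralZl//; last first.
  exact: integrable_tent_cos.
apply: le_Rintegral => //.
- exact: integrable_mulr (integrable_tent_cos 0).
- exact: integrable_tent_cos.
move=> s _; rewrite mulr0 cos0 mulr1.
rewrite /tent indicE mem_setE in_itv/=.
case: andP => [[s0 s1]|_] /=; last by rewrite !mul0r mulr0.
rewrite !mul1r mulrC ler_wpM2l//; first by rewrite mulr_ge0// subr_ge0.
have sy1 : `|s * y| <= 1 by rewrite normrM ger0_norm// mulr_ile1.
rewrite -(cos_norm (s * y)).
have pi1 : 1 <= pi :> R by have := pi_ge2 R; lra.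
have [e|ne] := eqVneq `|s * y| 1; first by rewrite e.
apply: ltW; rewrite ltr_cos ?in_itv/= ?normr_ge0 ?ler01 ?(le_trans sy1)//.
by rewrite lt_neqAle ne.
Qed.

End fejer_kernel.

(** * Cosine transforms *)

Section cosine_transform.
Context {R : realType}.
Notation leb := (@lebesgue_measure R).

Definition cos_transform (v : R -> R) (w : R) : R :=
  \int[leb]_t (cos (w * t) * v t).

Variable v : R -> R.
Hypothesis cv : continuous v.
Hypothesis iv : leb.-integrable setT (EFin \o v).

Let continuous_scale (f : R -> R) (w : R) : continuous f ->
  continuous (fun t : R => f (w * t)).
Proof.
move=> cf t; apply: (@continuous_comp _ _ _ (fun t : R => w * t)); last exact: cf.
by apply: cvgM; [exact: cvg_cst|exact: cvg_id].
Qed.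

Let imul (f g : R -> R) : continuous f -> (forall t, `|f t| <= 1) ->
  leb.-integrable setT (EFin \o g) ->
  leb.-integrable setT (EFin \o (fun t => f t * g t)).
Proof.
move=> cf f1 ig.
apply: (integrable_le_norm _ (integrable_norm ig)).
- apply: measurable_funM; first exact: continuous_measurable_fun.
  by apply/measurable_EFinP; exact: measurable_int ig.
- by move=> t; rewrite normrM ler_piMl.
Qed.

Lemma integrable_cosM (w : R) :
  leb.-integrable setT (EFin \o (fun t => cos (w * t) * v t)).
Proof.
apply: imul => // [|t]; last exact: cos_max.
exact: continuous_scale (@continuous_cos R).
Qed.

Lemma cos_transform_bounded (w : R) :
  `|cos_transform v w| <= \int[leb]_t `|v t|.
Proof.
apply: le_trans (le_normr_Rintegral measurableT (integrable_cosM w)) _.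
apply: le_Rintegral => //.
- exact: integrable_norm (integrable_cosM w).
- exact: integrable_norm iv.
- by move=> t _; rewrite normrM ler_piMl// cos_max.
Qed.

Lemma continuous_cos_transform : continuous (cos_transform v).
Proof.
move=> w.
have := @continuity_under_integral R _ (measurableTypeR R) leb
  (fun w t => cos (w * t) * v t) setT measurableT (w - 1) (w + 1) _ _
  (fun t => `|v t|) (integrable_norm iv) _.
move=> /(_ _ _ _ w); apply.
- by move=> x _; exact: integrable_cosM.
- apply: aeW => t _ x _; apply: cvgM; last exact: cvg_cst.
  apply: (@continuous_comp _ _ _ (fun x : R => x * t)); last exact: continuous_cos.
  by apply: cvgM; [exact: cvg_id|exact: cvg_cst].
- move=> x _; apply: aeW => t _ /=.
  by rewrite normrM ler_piMl// cos_max.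
- by rewrite inE/= in_itv/= ltrBlDr !ltrDl !ltr01.
Qed.

Lemma sin_transform0 (w : R) : (forall t, v (- t) = v t) ->
  \int[leb]_t (sin (w * t) * v t) = 0.
Proof.
move=> even_v.
have i : leb.-integrable setT (EFin \o (fun t => sin (w * t) * v t)).
  apply: imul => // [|t]; last exact: sin_max.
  exact: continuous_scale (@continuous_sin R).
have N10 : -1 != 0 :> R by rewrite oppr_eq0 oner_eq0.
have := Rintegral_affine 0 N10 i; rewrite normrN1 invr1 mul1r => E.
have iN : leb.-integrable setT (EFin \o (fun t => -1 * (sin (w * t) * v t))).
  exact: integrable_mulr.
have : \int[leb]_t (sin (w * t) * v t) = -1 * \int[leb]_t (sin (w * t) * v t).
  rewrite -[LHS]E -(RintegralZl (-1) measurableT i).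
  apply: eq_Rintegral => t _.
  by rewrite mulN1r addr0 even_v mulrN sinN mulNr mulN1r.
lra.
Qed.

Hypothesis shift_v : forall e : R, 0 < e -> exists2 d : R, 0 < d &
  forall h, `|h| <= d -> (\int[leb]_t (`|incr h v t|)%:E <= e%:E)%E.

(** The Riemann-Lebesgue lemma.  Translating by h = pi / w changes the sign of
    cos (w t), so twice the transform is the integral of - cos (w t) against
    v (t + h) - v t, whose L^1 norm is small. *)
Lemma cos_transform_vanishes (e : R) : 0 < e ->
  exists2 M : R, 0 < M & forall w, M <= `|w| -> `|cos_transform v w| <= e.
Proof.
move=> e0; have [d d0 dv] := shift_v e0.
have pi0 := pi_gt0 R.
exists (pi / d); first exact: divr_gt0.
move=> w Mw; have w0 : w != 0.
  by rewrite -normr_gt0 (lt_le_trans _ Mw)// divr_gt0.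
pose h := pi / w.
have hd : `|h| <= d.
  rewrite normrM normrV ?unitfE// (gtr0_norm pi0) ler_pdivrMr ?normr_gt0//.
  by rewrite mulrC -ler_pdivrMr.
have ih := integrable_cosM w.
have E1 : cos_transform v w = \int[leb]_t (- (cos (w * t) * v (t + h))).
  rewrite /cos_transform -(Rintegral_shift h ih).
  apply: eq_Rintegral => t _; rewrite mulrDr /h [w * (_ / _)]mulrC divfK//.
  by rewrite cosDpi mulNr.
have ivh : leb.-integrable setT (EFin \o (fun t => v (t + h))).
  exact (integrable_shift h iv).
have ii : leb.-integrable setT (EFin \o (fun t => cos (w * t) * v (t + h))).
  apply: imul => // [|t]; last exact: cos_max.
  exact: continuous_scale (@continuous_cos R).
have idv : leb.-integrable setT (EFin \o (incr h v)) by exact: integrable_subr.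
have iN : leb.-integrable setT (EFin \o (fun t => - (cos (w * t) * v (t + h)))).
  by have := integrable_mulr (-1) ii; apply: eq_integrable => // t _ /=; rewrite mulN1r.
have E2 : cos_transform v w *+ 2 = \int[leb]_t (- (cos (w * t) * incr h v t)).
  rewrite mulr2n {1}E1 /cos_transform -RintegralD//.
  by apply: eq_Rintegral => t _; rewrite /incr; ring.
have idc : leb.-integrable setT (EFin \o (fun t => - (cos (w * t) * incr h v t))).
  have ic : leb.-integrable setT (EFin \o (fun t => cos (w * t) * incr h v t)).
    apply: imul => // [|t]; last exact: cos_max.
    exact: continuous_scale (@continuous_cos R).
  by have := integrable_mulr (-1) ic; apply: eq_integrable => // t _ /=; rewrite mulN1r.
have : `|cos_transform v w *+ 2| <= e.
  rewrite E2; apply: le_trans (le_normr_Rintegral measurableT idc) _.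
  apply: (@le_trans _ _ (\int[leb]_t `|incr h v t|)).
    apply: le_Rintegral => //.
    - exact: integrable_norm idc.
    - exact: integrable_norm idv.
    - by move=> t _; rewrite normrN normrM ler_piMl// cos_max.
  rewrite -lee_fin /Rintegral fineK; first exact: dv.
  exact: integrable_fin_num (integrable_norm idv).
by rewrite normrMn mulr2n; have := normr_ge0 (cos_transform v w); lra.
Qed.

Hypothesis v0 : 0 < v 0.

Let F (N : R) (z : measurableTypeR R * measurableTypeR R) : \bar R :=
  (tent z.1 * cos (z.1 * (N * z.2)) * v z.2)%:E.

Let measurable_F N : measurable_fun setT (F N).
Proof.
apply/measurable_EFinP; apply: measurable_funM; last first.
  by apply: measurableT_comp => //; exact: continuous_measurable_fun.
apply: measurable_funM.
  apply: (@measurableT_comp _ _ _ _ _ _ tent) => //.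
  apply: measurable_funM; first exact: measurable_indic.
  by apply: measurable_funM => //; apply: measurable_funB.
apply: (@measurableT_comp _ _ _ _ _ _ (@cos R)).
  exact: continuous_measurable_fun (@continuous_cos R).
by apply: measurable_funM => //; apply: measurable_funM.
Qed.

Let integrable_F N : (leb \x leb)%E.-integrable setT (F N).
Proof.
apply/(integrable12ltyP leb leb (@measurable_F N)).
pose c : R := \int[leb]_t `|v t|.
have cE : (\int[leb]_t (`|v t|)%:E = c%:E)%E.
  by rewrite /c /Rintegral fineK//; exact: integrable_fin_num (integrable_norm iv).
have c0 : 0 <= c by apply: Rintegral_ge0.
apply: (@le_lt_trans _ _ (\int[leb]_s (2 * c * \1_`[0%R, 1%R] s)%:E)%E).
  apply: ge0_le_integral => //.
  - by move=> s _; apply: integral_ge0 => t _.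
  - apply: (@measurable_fun_fubini_tonelli_F _ _ _ _ _ leb (abse \o F N)).
      exact: measurableT_comp.
    by move=> z; exact: abse_ge0.
  - apply/measurable_EFinP; apply: measurable_funM => //; exact: measurable_indic.
  - move=> s _; apply: (@le_trans _ _ (\int[leb]_t ((2 * \1_`[0%R, 1%R] s)%:E * (`|v t|)%:E))%E).
      apply: ge0_le_integral => //.
      + apply: measurableT_comp => //; apply/measurable_EFinP.
        have cc : continuous (fun t : R => cos (s * (N * t))).
          exact: (@continuous_scale (fun u => cos (s * u)) N
            (@continuous_scale (@cos R) s (@continuous_cos R))).
        apply: measurable_funM; last exact: continuous_measurable_fun.
        apply: measurable_funM; first exact (measurable_cst (tent s)).
        exact (continuous_measurable_fun cc).
      + apply: emeasurable_funM => //; apply/measurable_EFinP.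
        by apply: measurableT_comp => //; exact: continuous_measurable_fun.
      + move=> t _; rewrite /F /= -EFinM lee_fin normrM [`|tent s * _|]normrM.
        rewrite ler_wpM2r// (ger0_norm (tent_ge0 _)).
        by rewrite (le_trans _ (tent_le s))// ler_piMr ?tent_ge0// cos_max.
    rewrite ge0_integralZl//.
    + by rewrite cE -EFinM lee_fin mulrAC.
    + apply/measurable_EFinP; apply: measurableT_comp => //.
      exact: continuous_measurable_fun.
have -> : (\int[leb]_s (2 * c * \1_`[0%R, 1%R] s)%:E = (2 * c * 1)%:E)%E.
  under eq_integral do rewrite EFinM.
  rewrite ge0_integralZl//.
  - by rewrite integral_indic//= setIT lebesgue_measure_itv/= lte_fin ltr01 oppr0 adde0.
  - by apply/measurable_EFinP; exact: measurable_indic.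
  - by rewrite lee_fin mulr_ge0.
by rewrite ltry.
Qed.

Let fubini_G_E N : fubini_G leb (F N) = EFin \o (fun t => v t * fejer (N * t)).
Proof.
apply/funext => t; have i := integrable_tent_cos (N * t).
rewrite /fejer /= -RintegralZl//= /Rintegral fineK.
  by apply: eq_integral => s _; rewrite /F /= [in LHS]mulrC.
exact: (integrable_fin_num measurableT (integrable_mulr (v t) i)).
Qed.

Let fubini_F_E N : fubini_F leb (F N) = EFin \o (fun s => tent s * cos_transform v (s * N)).
Proof.
apply/funext => s; have i := integrable_cosM (s * N).
rewrite /cos_transform /= -RintegralZl//= /Rintegral fineK.
  by apply: eq_integral => t _; rewrite /F /= !mulrA.
exact: (integrable_fin_num measurableT (integrable_mulr (tent s) i)).
Qed.

(** Fubini's theorem for tent s * cos (N s t) * v t. *)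
Lemma cos_transform_fejer N :
  \int[leb]_s (tent s * cos_transform v (s * N)) =
  \int[leb]_t (v t * fejer (N * t)).
Proof.
rewrite /Rintegral.
have := integral12_prod_meas1 (@integrable_F N).
have := integral21_prod_meas1 (@integrable_F N).
by rewrite fubini_G_E fubini_F_E => -> /(f_equal fine).
Qed.

Let integrable_v_fejer N :
  leb.-integrable setT (EFin \o (fun t => v t * fejer (N * t))).
Proof.
apply: (integrable_le_norm _ (integrable_norm iv)).
  apply/measurable_EFinP; rewrite -fubini_G_E.
  exact: measurable_fubini_G (@integrable_F N).
move=> t; rewrite normrM ler_piMr// (ger0_norm (fejer_ge0 _)).
exact: fejer_le1.
Qed.

(** If the transform were nonpositive, so would be the integral of
    v t * fejer (N t) for every N.  But this integral is positive for N large: the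
    interval |t| <= 1/N contributes at least v(0) cos 1 / N, the rest of the
    neighbourhood |t| <= d where v >= v(0) / 2 contributes a nonnegative amount, and
    the tail |t| > d is O(1 / N^2). *)
Lemma cos_transform_pos : exists w, 0 < cos_transform v w.
Proof.
apply: contrapT => /forallNP H.
have C0 w : cos_transform v w <= 0 by rewrite leNgt; apply/negP; exact: H.
have [d d0 dv] : exists2 d : R, 0 < d & forall t, `|t| <= d -> v 0 / 2 <= v t.
  have /cvgrPdist_le /(_ (v 0 / 2)) := @cv 0.
  rewrite divr_gt0// => /(_ isT) [d /= d0 dv].
  exists (d / 2); first by rewrite divr_gt0.
  move=> t td; have := dv t; rewrite /= sub0r normrN => /(_ _).
  have td' : `|t| < d by lra.
  by move=> /(_ td'); rewrite ler_norml; lra.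
pose c : R := \int[leb]_t `|v t|.
have c0 : 0 <= c by apply: Rintegral_ge0.
have k0 : 0 < cos 1 :> R by exact: cos1_gt0.
have Q0 : 0 < d ^+ 2 * (v 0 * cos 1) by rewrite !mulr_gt0// exprn_gt0.
(* N exceeds 1/d, and exceeds the ratio q at which the tail bound
   4 c / (N d)^2 equals the main term v(0) cos 1 / N. *)
pose q : R := 4 * c / (d ^+ 2 * (v 0 * cos 1)).
have q0 : 0 <= q by rewrite divr_ge0 ?mulr_ge0// ltW.
have d'0 : 0 < d^-1 by rewrite invr_gt0.
pose N : R := d^-1 + q + 1.
have N0 : 0 < N by rewrite /N; lra.
have Nd : N^-1 <= d.
  by rewrite -[leRHS]invrK lef_pV2 ?posrE// /N; lra.
have Nbig : 4 * c / (N ^+ 2 * d ^+ 2) < v 0 * cos 1 / N.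
  rewrite ltr_pdivrMr; last by rewrite mulr_gt0// exprn_gt0.
  rewrite (_ : v 0 * cos 1 / N * _ = N * (d ^+ 2 * (v 0 * cos 1))); last by field; rewrite gt_eqF.
  by rewrite -ltr_pdivrMr// -/q /N; lra.
have : \int[leb]_t (v t * fejer (N * t)) <= 0.
  rewrite -cos_transform_fejer.
  rewrite -oppr_ge0 -mulN1r -RintegralZl//; last first.
    by rewrite -fubini_F_E; exact: integrable_fubini_F.
  by apply: Rintegral_ge0 => s _; rewrite mulN1r -mulrN mulr_ge0 ?tent_ge0 ?oppr_ge0.
apply/negP; rewrite -ltNge.
have i2 : leb.-integrable setT (EFin \o (\1_`[(- N^-1), N^-1] : R -> R)).
  exact: integrable_indic_itv.
have i1 := integrable_mulr (v 0 / 2 * cos 1) i2.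
apply: (@lt_le_trans _ _ (\int[leb]_t ((v 0 / 2 * cos 1) * \1_`[(- N^-1), N^-1] t
    + - (4 / (N ^+ 2 * d ^+ 2)) * `|v t|))).
  rewrite RintegralD//; last exact: integrable_mulr (integrable_norm iv).
  rewrite RintegralZl// RintegralZl//; last exact: (integrable_norm iv).
  rewrite Rintegral_indic; last by rewrite ge0_cp// invr_ge0 ltW.
  rewrite -/c opprK; move: Nbig; rewrite mulNr; rewrite [4 * c / _]mulrAC.
  lra.
apply: le_Rintegral => //.
- exact: integrable_addr i1 (integrable_mulr _ (integrable_norm iv)).
move=> t _; rewrite indicE mem_setE in_itv/= -ler_norml.
have e0 : 0 <= 4 / (N ^+ 2 * d ^+ 2) * `|v t|.
  by rewrite mulr_ge0// divr_ge0// mulr_ge0// sqr_ge0.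
have [tN|tN] := lerP `|t| N^-1 => /=.
  have vt := dv t (le_trans tN Nd).
  have kt : cos 1 <= fejer (N * t).
    by apply: fejer_ge; rewrite normrM gtr0_norm// mulrC -ler_pdivlMr// mul1r.
  rewrite mulr1 mulNr.
  have : v 0 / 2 * cos 1 <= v t * fejer (N * t).
    by rewrite ler_pM// ?divr_ge0// ltW.
  lra.
rewrite mulr0 add0r mulNr.
have [td|td] := lerP `|t| d.
  have vt := dv t td.
  have vt0 : 0 <= v t by apply: le_trans vt; rewrite divr_ge0// ltW.
  have : 0 <= v t * fejer (N * t) by rewrite mulr_ge0 ?fejer_ge0.
  lra.
have t0 : t != 0 by rewrite -normr_gt0 (lt_trans d0).
have kt : fejer (N * t) <= 4 / (N ^+ 2 * d ^+ 2).
  apply: le_trans (fejer_le _) _; first by rewrite mulf_neq0// gt_eqF.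
  rewrite ler_wpM2l// lef_pV2 ?posrE.
  - rewrite exprMn ler_wpM2l ?sqr_ge0// -(real_normK (num_real t)).
    by rewrite ler_pXn2r ?nnegrE// ltW.
  - by rewrite exprn_even_gt0//= mulf_neq0// gt_eqF.
  - by rewrite mulr_gt0// exprn_gt0.
have : `|v t * fejer (N * t)| <= 4 / (N ^+ 2 * d ^+ 2) * `|v t|.
  by rewrite normrM mulrC (ger0_norm (fejer_ge0 _)) ler_wpM2r.
by rewrite ler_norml => /andP[].
Qed.

(** A continuous function vanishing at infinity and positive at w1 attains its
    maximum on a segment outside of which it is below its value at w1. *)
Lemma cos_transform_max :
  exists w0, 0 < cos_transform v w0 /\ forall w, cos_transform v w <= cos_transform v w0.
Proof.
have [w1 Cw1] := cos_transform_pos.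
have [M M0 CM] := cos_transform_vanishes Cw1.
(* The segment must contain w1 itself. *)
have M'M : - Num.max M `|w1| <= Num.max M `|w1|.
  by rewrite ge0_cp// le_max normr_ge0 orbT.
have [w0 w0M w0max] := EVT_max M'M (continuous_subspaceT continuous_cos_transform).
have w01 : cos_transform v w1 <= cos_transform v w0.
  by apply: w0max; rewrite in_itv/= -ler_norml le_max lexx orbT.
exists w0; split; first exact: lt_le_trans w01.
move=> w; have [wM|wM] := lerP `|w| (Num.max M `|w1|).
  by apply: w0max; rewrite in_itv/= -ler_norml.
apply: le_trans w01; apply: le_trans (ler_norm _) _; apply: CM.
by rewrite (le_trans _ (ltW wM))// le_max lexx.
Qed.

End cosine_transform.

(** * Square integrable random variables *)

Section square_integrable.
Context {R : realType} {d : measure_display} {T : measurableType d}.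
Context {P : probability T R}.
Implicit Types X Y Z : T -> R.

Notation L2 := (Lfun P 2%:E).

(** The scalar product of L^2(P). *)
Definition ip X Y : R := fine ('E_P[X \* Y])%E.

Lemma L2_measurable X : X \in L2 -> measurable_fun setT X.
Proof. by rewrite inE => /andP[/[!inE]]. Qed.

Lemma L2_intro X : measurable_fun setT X ->
  (\int[P]_w ((X w) ^+ 2)%:E < +oo)%E -> X \in L2.
Proof.
move=> mX X2; rewrite inE; apply/andP; split; rewrite inE//=.
rewrite /finite_norm unlock /Lnorm poweR_lty//=.
rewrite (eq_integral (fun w => ((X w) ^+ 2)%:E))// => w _.
by rewrite powR_mulrn// real_normK ?num_real.
Qed.

Lemma L2_mul_integrable X Y : X \in L2 -> Y \in L2 ->
  P.-integrable setT (EFin \o (fun w => X w * Y w)).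
Proof. by move=> hX hY; apply/Lfun1_integrable; exact: Lfun2_mul_Lfun1. Qed.

Lemma ipE X Y : ip X Y = \int[P]_w (X w * Y w).
Proof. by rewrite /ip unlock. Qed.

Lemma expectation_ip X Y : X \in L2 -> Y \in L2 ->
  ('E_P[X \* Y])%E = (ip X Y)%:E.
Proof.
move=> hX hY; rewrite /ip fineK// unlock.
exact: integrable_fin_num (L2_mul_integrable hX hY).
Qed.

Lemma ipC X Y : ip X Y = ip Y X.
Proof. by rewrite !ipE; apply: eq_Rintegral => w _; rewrite mulrC. Qed.

Lemma L2B X Y : X \in L2 -> Y \in L2 -> (fun w => X w - Y w) \in L2.
Proof. by move=> hX hY; rewrite (_ : (fun w => _) = (X - Y)%R)// rpredB ?lee1n. Qed.

Lemma L2Z (c : R) X : X \in L2 -> (fun w => c * X w) \in L2.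
Proof.
move=> hX; rewrite (_ : (fun w => _) = c \o* X).
  by apply: Lfun_scale; rewrite ?ler1n.
by apply/funext => w /=; rewrite mulrC.
Qed.

Lemma ipBl X Y Z : X \in L2 -> Y \in L2 -> Z \in L2 ->
  ip (fun w => X w - Y w) Z = ip X Z - ip Y Z.
Proof.
move=> hX hY hZ; rewrite !ipE -RintegralB//; try exact: L2_mul_integrable.
by apply: eq_Rintegral => w _; rewrite mulrBl.
Qed.

Lemma ipZl (c : R) X Z : X \in L2 -> Z \in L2 ->
  ip (fun w => c * X w) Z = c * ip X Z.
Proof.
move=> hX hZ; rewrite !ipE -RintegralZl//; last exact: L2_mul_integrable.
by apply: eq_Rintegral => w _; rewrite mulrA.
Qed.

Lemma ip_ge0 X : 0 <= ip X X.
Proof. by rewrite ipE; apply: Rintegral_ge0 => w _; rewrite -expr2 sqr_ge0. Qed.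

(** Young's inequality stands in for that of Cauchy and Schwarz: the free
    parameter c is adjusted to the order of magnitude of X. *)
Lemma ip_young (c : R) X Y : 0 < c -> X \in L2 -> Y \in L2 ->
  `|ip X Y| <= c * ip X X + c^-1 * ip Y Y.
Proof.
move=> c0 hX hY; rewrite !ipE.
have iXX := L2_mul_integrable hX hX; have iYY := L2_mul_integrable hY hY.
have iXY := L2_mul_integrable hX hY.
rewrite -!RintegralZl// -RintegralD//; try exact: integrable_mulr.
apply: le_trans (le_normr_Rintegral measurableT iXY) _.
apply: le_Rintegral => //.
- exact: integrable_norm iXY.
- exact: integrable_addr (integrable_mulr _ iXX) (integrable_mulr _ iYY).
move=> w _; rewrite normrM -[X w * X w]expr2 -[Y w * Y w]expr2.
rewrite -(real_normK (num_real (X w))) -(real_normK (num_real (Y w))).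
have H x y : 0 <= x -> 0 <= y -> x * y <= c * x ^+ 2 + c^-1 * y ^+ 2.
  move=> x0 y0; rewrite -(ler_pM2l c0) mulrDr [c * (c^-1 * _)]mulrA mulfV ?gt_eqF// mul1r.
  have := sqr_ge0 (c * x - y); have : 0 <= c * x * y by rewrite !mulr_ge0// ltW.
  nra.
exact: H.
Qed.

(** The weight that makes the Y-term of [ip_young] negligible, leaving a multiple of
    the norm of X. *)
Lemma ip_young_weight Y (e : R) : 0 < e ->
  exists2 c : R, 0 < c & c^-1 * ip Y Y <= e / 2.
Proof.
move=> e0; have Y1 : 0 < ip Y Y + 1 by rewrite ltr_wpDl// ip_ge0.
exists ((ip Y Y + 1) * 2 / e); first by rewrite divr_gt0// mulr_gt0.
rewrite invf_div mulrAC ler_pdivrMr; last by rewrite mulr_gt0.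
rewrite (_ : e / 2 * _ = e * (ip Y Y + 1)); last by field.
by rewrite ler_pM2l// lerDl.
Qed.

Lemma L2_sum (N : nat) (c : nat -> R) (X : nat -> T -> R) :
  (forall i, X i \in L2) ->
  (fun w => \sum_(0 <= i < N) c i * X i w) \in L2.
Proof.
move=> hX; elim: N => [|N IH].
  rewrite (_ : (fun w => _) = cst 0); first exact: Lfun_cst.
  by apply/funext => w; rewrite big_nil.
rewrite (_ : (fun w => _) =
    (fun w => \sum_(0 <= i < N) c i * X i w - (- c N) * X N w)).
  exact: L2B IH (L2Z (- c N) (hX N)).
by apply/funext => w; rewrite big_nat_recr//= mulNr opprK.
Qed.

Lemma ip_sum (N : nat) (c : nat -> R) (X : nat -> T -> R) Z :
  (forall i, X i \in L2) -> Z \in L2 ->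
  ip (fun w => \sum_(0 <= i < N) c i * X i w) Z = \sum_(0 <= i < N) c i * ip (X i) Z.
Proof.
move=> hX hZ; elim: N => [|N IH].
  rewrite big_nil ipE -[RHS](Rintegral_set0 P (fun=> 0)) /Rintegral; congr fine.
  rewrite integral_set0; apply: integral0_eq => w _.
  by rewrite big_nil mul0r.
rewrite big_nat_recr//= -IH.
have E : (fun w => \sum_(0 <= i < N.+1) c i * X i w) =
    (fun w => \sum_(0 <= i < N) c i * X i w - (- c N) * X N w).
  by apply/funext => w; rewrite big_nat_recr//= mulNr opprK.
rewrite E (ipBl (L2_sum N c hX) (L2Z (- c N) (hX N)) hZ) ipZl// mulNr opprK.
by [].
Qed.

Lemma ms_errorE X Y : X \in L2 -> Y \in L2 ->
  ms_error (P := P) X Y = (ip (fun w => X w - Y w) (fun w => X w - Y w))%:E.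
Proof.
move=> hX hY; rewrite -expectation_ip; try exact: L2B.
by rewrite /ms_error; congr ('E_P[_])%E; apply/funext => w /=; rewrite expr2.
Qed.

(** A random variable at finite mean-square distance of L^2(P) lies in it: this is
    how Wiener integrals are seen to be square integrable. *)
Lemma ms_error_L2 X Y : X \in L2 -> measurable_fun setT Y ->
  (ms_error (P := P) X Y < +oo)%E -> Y \in L2.
Proof.
move=> hX mY XY.
have hD : (fun w => X w - Y w) \in L2.
  apply: L2_intro; last by move: XY; rewrite /ms_error unlock.
  by apply: measurable_funB => //; exact: L2_measurable.
rewrite (_ : Y = (fun w => X w - (X w - Y w))); first exact: L2B.
by apply/funext => w; ring.
Qed.

Lemma ip_triangle X Y Z : X \in L2 -> Y \in L2 -> Z \in L2 ->
  ip (fun w => X w - Z w) (fun w => X w - Z w) <=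
  2 * ip (fun w => X w - Y w) (fun w => X w - Y w) +
  2 * ip (fun w => Y w - Z w) (fun w => Y w - Z w).
Proof.
move=> hX hY hZ; rewrite !ipE.
have i1 := L2_mul_integrable (L2B hX hZ) (L2B hX hZ).
have i2 := L2_mul_integrable (L2B hX hY) (L2B hX hY).
have i3 := L2_mul_integrable (L2B hY hZ) (L2B hY hZ).
rewrite -!RintegralZl// -RintegralD//; try exact: integrable_mulr.
apply: le_Rintegral => //.
- exact: integrable_addr (integrable_mulr _ i2) (integrable_mulr _ i3).
move=> w _; have := sqr_ge0 ((X w - Y w) - (Y w - Z w)); nra.
Qed.

End square_integrable.

(** * Uniform partitions *)

Section uniform_partition.
Context {R : realType}.

Definition node (a t : R) (N : nat) (i : nat) : R := a + i%:R * ((t - a) / N%:R).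

Lemma node0 a t N : node a t N 0 = a.
Proof. by rewrite /node mul0r addr0. Qed.

Lemma node_last a t N : (0 < N)%N -> node a t N N = t.
Proof.
by move=> N0; rewrite /node mulrC divfK ?pnatr_eq0 -?lt0n//; ring.
Qed.

Lemma nodeS a t N i : node a t N i.+1 = node a t N i + (t - a) / N%:R.
Proof. by rewrite /node -natr1; ring. Qed.

Lemma node_le a t N i : a <= t -> node a t N i <= node a t N i.+1.
Proof. by move=> at_; rewrite nodeS lerDl divr_ge0 ?subr_ge0. Qed.

Lemma node_lt a t N i : a < t -> (0 < N)%N -> node a t N i < node a t N i.+1.
Proof. by move=> at_ N0; rewrite nodeS ltrDl divr_gt0 ?subr_gt0 ?ltr0n. Qed.

(** Without the initial node a, to match the encoding of [itv_partition]. *)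
Definition nodes (a t : R) (N : nat) : seq R := mkseq (fun i => node a t N i.+1) N.

Lemma nth_nodes b a t N i : (i <= N)%N -> nth b (a :: nodes a t N) i = node a t N i.
Proof.
case: i => [|i] iN; first by rewrite /= node0.
by rewrite /= nth_mkseq.
Qed.

Lemma nodes_partition a t N : a < t -> (0 < N)%N -> itv_partition a t (nodes a t N).
Proof.
move=> at_ N0; split.
  apply/(pathP a) => i; rewrite size_mkseq => iN.
  rewrite nth_nodes ?(ltnW iN)// nth_mkseq//.
  exact: node_lt.
rewrite (last_nth a) size_mkseq nth_nodes// node_last//.
Qed.

(** The nodes above w are exactly those from the first one, u k, onwards.  The last
    clause says that u k is the first: either there is no earlier node or the
    previous one is below w. *)
Lemma sum_above_telescope (u : nat -> R) (r : R -> R) (w : R) (N : nat) :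
  (forall i, u i <= u i.+1) -> w <= u N ->
  exists k, [/\ (k <= N)%N, w <= u k,
    \sum_(0 <= i < N) (w <= u i)%R%:R * (r (u i.+1) - r (u i)) = r (u N) - r (u k) &
    k = 0%N \/ u k.-1 < w].
Proof.
move=> und; elim: N => [|N IH] wN.
  by exists 0%N; split; rewrite ?big_nil ?subrr//; left.
rewrite big_nat_recr//=.
case: (lerP w (u N)) => [wuN|uNw].
  have [k [kN wk E H]] := IH wuN; exists k; split=> //; first exact: leqW.
  by rewrite E mul1r; ring.
exists N.+1; split=> //; last by right.
rewrite mul0r addr0 subrr big_nat_cond big1// => i /andP[/andP[_ iN] _].
have ui : u i <= u N.
  by apply: (homo_leq lexx le_trans und); exact: ltnW.
by rewrite leNgt (le_lt_trans ui uNw) mul0r.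
Qed.

End uniform_partition.

(** * Stieltjes sums against an exponential integrand *)

Section expo_riemann_stieltjes.
Context {R : realType}.

(** Each integrand value exp (- al (t - u)) is the probability that
    S >= al (t - u), S exponential, which turns this sum into an expectation. *)
Definition rs_sum (al : R) (r : R -> R) (t a : R) (N : nat) : R :=
  \sum_(0 <= i < N) expR (- al * (t - node a t N i)) *
     (r (node a t N i.+1) - r (node a t N i)).

(** The random variable whose expectation is [rs_sum]: the increments of r over
    the cells whose left end is above t - S / al. *)
Let step (al : R) (r : R -> R) (t a : R) (N : nat) (s : R) : R :=
  \sum_(0 <= i < N) (t - s / al <= node a t N i)%R%:R *
     (r (node a t N i.+1) - r (node a t N i)).

Lemma node_le_last (a t : R) N i : a <= t -> (i <= N)%N -> (0 < N)%N -> node a t N i <= t.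
Proof.
move=> at_ iN N0; rewrite -[leRHS](node_last a t N0).
by apply: (homo_leq lexx le_trans (fun k => node_le N k at_)).
Qed.

(** The indicator of [t - s / al <= node] is that of a ray in s, whose probability
    is given by [expo_ray]. *)
Let rs_sumE (al : R) (r : R -> R) (t a : R) (N : nat) : 0 < al -> a < t -> (0 < N)%N ->
  rs_sum al r t a N = \int[@expo R]_(s in `[0, +oo[) step al r t a N s /\
  measurable_fun setT (step al r t a N).
Proof.
move=> al0 at_ N0; pose D i := r (node a t N i.+1) - r (node a t N i).
have iJ x : (@expo R).-integrable setT (EFin \o (\1_`[x, +oo[ : R -> R)).
  exact: integrable_indic.
have stepE M (s : R) : \sum_(0 <= i < M) (t - s / al <= node a t N i)%R%:R * D i =
   \sum_(0 <= i < M) D i * \1_`[al * (t - node a t N i), +oo[ s.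
  apply: eq_bigr => i _; rewrite mulrC indicE mem_setE in_itv/= andbT.
  congr (_ * (_ : bool)%:R).
  by rewrite lerBlDr -lerBlDl ler_pdivlMr// mulrC.
have H M : (M <= N)%N ->
   (@expo R).-integrable setT (EFin \o (fun s =>
     \sum_(0 <= i < M) D i * \1_`[al * (t - node a t N i), +oo[ s)) /\
   \int[@expo R]_s (\sum_(0 <= i < M) D i * \1_`[al * (t - node a t N i), +oo[ s) =
   \sum_(0 <= i < M) expR (- al * (t - node a t N i)) * D i.
  elim: M => [|M IH] MN.
    split.
      apply: eq_integrable (finite_measure_integrable_cst _ 0 measurableT) => // s _ /=.
      by rewrite big_nil.
    rewrite big_nil -[RHS]expo_Rintegral_cst; apply: eq_Rintegral => s _.
    by rewrite big_nil.
  have [iM EM] := IH (ltnW MN).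
  have iM1 := integrable_mulr (D M) (iJ (al * (t - node a t N M))).
  split.
    have := integrable_addr iM iM1; apply: eq_integrable => // s _ /=.
    by rewrite big_nat_recr.
  rewrite big_nat_recr//= -EM.
  have -> : expR (- al * (t - node a t N M)) * D M =
      \int[@expo R]_s (D M * \1_`[al * (t - node a t N M), +oo[ s).
    rewrite RintegralZl// mulrC; congr (_ * _).
    rewrite /Rintegral integral_indic// setIT mulNr.
    have h0 : 0 <= al * (t - node a t N M).
      by rewrite mulr_ge0 ?(ltW al0)// subr_ge0 node_le_last ?(ltW at_)// ltnW.
    exact/esym/(f_equal fine (expo_ray h0)).
  rewrite -RintegralD//.
  by apply: eq_Rintegral => s _; rewrite big_nat_recr.
have [iN EN] := H N (leqnn N).
have stepE' : step al r t a N =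
    fun s => \sum_(0 <= i < N) D i * \1_`[al * (t - node a t N i), +oo[ s.
  by apply/funext => s; rewrite -stepE.
rewrite stepE'; split.
  by rewrite -expo_integral_itv// EN.
by apply/measurable_EFinP; exact: measurable_int iN.
Qed.

(** Summation by parts in disguise.  By [sum_above_telescope] the step function is
    r t - r u for the first node u above t - s / al, so it converges pointwise by
    continuity of r; the growth bound on r provides a dominating function that is
    affine in s, hence integrable. *)
Lemma cvg_rs_sum (al C : R) (r : R -> R) (t : R) (a : nat -> R) (N : nat -> nat) :
  0 < al -> continuous r -> (forall u, `|r t - r u| <= C * (1 + `|t - u|)) ->
  (forall n, a n < t - n%:R) -> (forall n, (0 < N n)%N) ->
  (forall n, (t - a n) / (N n)%:R < n.+1%:R^-1) ->
  rs_sum al r t (a n) (N n) @[n --> \oo] --> \int[@expo R]_s (r t - r (t - s / al)).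
Proof.
move=> al0 cr rC atn N0 mesh.
have C0 : 0 <= C.
  by have := rC t; rewrite !subrr normr0 addr0 mulr1.
have atlt n : a n < t by rewrite (lt_le_trans (atn n))// lerBlDr lerDl.
have al'0 : 0 < al^-1 by rewrite invr_gt0.
pose f n s := step al r t (a n) (N n) s.
pose L s := r t - r (t - s / al).
have mL : measurable_fun [set: measurableTypeR R] L.
  apply: continuous_measurable_fun => s; apply: cvgB; first exact: cvg_cst.
  apply: (@continuous_comp _ _ _ (fun s : R => t - s / al)); last exact: cr.
  apply: cvgB; first exact: cvg_cst.
  by apply: cvgM; [exact: cvg_id|exact: cvg_cst].
have dom u s : t - s / al <= u -> u <= t ->
    `|r t - r u| <= C * (1 + al^-1) * (1 + `|s|).
  move=> wu ut; apply: le_trans (rC _) _; rewrite -mulrA ler_wpM2l//.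
  have sal : `|t - u| <= al^-1 * `|s|.
    rewrite ger0_norm ?subr_ge0//; apply: (@le_trans _ _ (al^-1 * s)).
      by rewrite (mulrC al^-1); lra.
    by rewrite ler_wpM2l ?ler_norm// ltW.
  have := normr_ge0 s; lra.
have tele n s : 0 <= s -> exists k, [/\ (k <= N n)%N,
    t - s / al <= node (a n) t (N n) k, node (a n) t (N n) k <= t,
    f n s = r t - r (node (a n) t (N n) k) &
    k = 0%N \/ node (a n) t (N n) k.-1 < t - s / al].
  move=> s0; have wt : t - s / al <= node (a n) t (N n) (N n).
    by rewrite node_last// lerBlDr lerDl divr_ge0// ltW.
  have [k [kN wk E H]] := sum_above_telescope r
    (fun i => node_le (N n) i (ltW (atlt n))) wt.
  exists k; split => //; first by rewrite node_le_last// ltW.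
  by rewrite /f /step E node_last.
have iL : (@expo R).-integrable setT (EFin \o (fun s => C * (1 + al^-1) * (1 + `|s|))).
  exact: integrable_mulr (@integrable_expo_affine R).
have iLL : (@expo R).-integrable setT (EFin \o L).
  apply: (integrable_le_norm mL iL) => /= s.
  apply: le_trans (rC _) _; rewrite -mulrA ler_wpM2l//.
  have -> : t - (t - s / al) = s * al^-1 by ring.
  rewrite normrM (ger0_norm (ltW al'0)).
  have := normr_ge0 s; have : 0 <= `|s| * al^-1 by rewrite mulr_ge0// ltW.
  lra.
have mD : measurable (`[0, +oo[%classic : set (measurableTypeR R)) by [].
have cvgf s : 0 <= s -> f n s @[n --> \oo] --> L s.
  move=> s0; apply/cvgrPdist_le => e e0.
  have /cvgrPdist_le /(_ e e0) [d /= d0 dr] := cr (t - s / al).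
  near=> n.
  have [k [kN wk kt -> H]] := tele n s s0.
  rewrite /L (_ : _ - _ - _ = - (r (t - s / al) - r (node (a n) t (N n) k))); last ring.
  rewrite normrN; apply: dr => /=; rewrite distrC ger0_norm ?subr_ge0//.
  have nd : n.+1%:R^-1 < d by near: n; exact: near_infty_natSinv_lt (PosNum d0).
  have ns : s / al <= n%:R by near: n; exact: nbhs_infty_ger.
  have aw : a n < t - s / al by rewrite (lt_le_trans (atn n))// lerB.
  case: k kN wk kt H => [|k] kN wk kt.
    by move: wk; rewrite node0 leNgt aw.
  case=> // H; rewrite nodeS; have := lt_trans (mesh n) nd.
  move: H => /=; move: (node _ _ _ k) (_ / _ : R) (s / al) => x y z.
  lra.
pose D : set (measurableTypeR R) := `[0, +oo[%classic.
have D0 s : D s -> 0 <= s by rewrite /D/= in_itv/= andbT.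
have mf n : measurable_fun D (EFin \o f n).
  apply/measurable_EFinP; apply: measurable_funTS.
  exact: (rs_sumE r al0 (atlt n) (N0 n)).2.
have mL' : measurable_fun D (EFin \o L).
  by apply/measurable_EFinP; exact: measurable_funTS.
have fL : {ae @expo R, forall s, D s -> (EFin \o f n) s @[n --> \oo] --> (EFin \o L) s}.
  by apply: aeW => s Ds; apply: cvg_EFin; [exact: nearW|exact: cvgf (D0 _ Ds)].
have iD := integrableS measurableT mD (@subsetT _ D) iL.
have fg : {ae @expo R, forall s n, D s -> (`|(EFin \o f n) s| <=
    (EFin \o (fun s => C * (1 + al^-1) * (1 + `|s|)))%R s)%E}.
  apply: aeW => s n Ds /=; rewrite lee_fin.
  by have [k [_ wk kt -> _]] := tele n s (D0 _ Ds); exact: dom.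
have [_ _] := dominated_convergence mD mf mL' fL iD fg.
have iLD := integrableS measurableT mD (@subsetT _ D) iLL.
rewrite -(fineK (integrable_fin_num mD iLD)) => /fine_cvg.
rewrite (expo_integral_itv iLL).
suff -> : (fun n => rs_sum al r t (a n) (N n)) =
    (fun n => fine (\int[@expo R]_(s in D) (f n s)%:E)%E) by [].
by apply/funext => n; rewrite (rs_sumE r al0 (atlt n) (N0 n)).1.
Unshelve. all: by end_near. Qed.

End expo_riemann_stieltjes.

(** * Scalar products with Wiener integrals *)

Section wiener_integral.
Context {R : realType} {d : measure_display} {T : measurableType d}.
Context {P : probability T R}.
Implicit Types (W : R -> {RV P >-> R}) (I J : {RV P >-> R}) (Y : T -> R).
Notation L2 := (Lfun P 2%:E).
Notation mse := (ms_error (P := P)).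
Notation ipP := (ip (P := P)).

Definition rs_var (f : R -> R) W (a t : R) (N : nat) (w : T) : R :=
  \sum_(0 <= i < N) f (node a t N i) * (W (node a t N i.+1) w - W (node a t N i) w).

Lemma RS_sum_nodes f W a t N :
  RS_sum f W a t (nodes a t N) (node a t N) = rs_var f W a t N.
Proof.
apply/funext => w; rewrite /RS_sum size_mkseq; apply: eq_big_nat => i /andP[_ iN].
by rewrite !nth_nodes// ltnW.
Qed.

Lemma L2_rs_var f W a t N : (forall u, (W u : T -> R) \in L2) ->
  rs_var f W a t N \in L2.
Proof. by move=> hW; apply: L2_sum => i; exact: L2B. Qed.

Lemma wiener_approx f W t (a : R) (J : {RV P >-> R}) (e : R) :
  a < t -> is_wiener_integral f W a t J -> 0 < e ->
  exists N, [/\ (0 < N)%N, (t - a) / N%:R < e &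
    (mse (rs_var f W a t N) J < e%:E)%E].
Proof.
move=> at_ hJ e0; have [del del0 H] := hJ _ e0.
have m0 : 0 < Num.min del e by rewrite lt_min del0.
pose N := (Num.truncn ((t - a) / Num.min del e)).+1.
have hN : (t - a) / N%:R < Num.min del e.
  rewrite ltr_pdivrMr ?ltr0n// mulrC -ltr_pdivrMr//.
  by rewrite /N truncnS_gt.
exists N; split => //; first by apply: lt_le_trans hN _; rewrite ge_min lexx orbT.
rewrite -RS_sum_nodes; apply: H.
  split; first exact: nodes_partition.
  move=> i; rewrite size_mkseq => iN; rewrite !nth_nodes ?(ltnW iN)// lexx/=.
  by rewrite node_le// ltW.
move=> i; rewrite size_mkseq => iN; rewrite !nth_nodes ?(ltnW iN)// nodeS addrC addKr.
by apply: lt_le_trans hN _; rewrite ge_min lexx.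
Qed.

Lemma wiener_integral_L2 f W a t J : (forall u, (W u : T -> R) \in L2) ->
  a < t -> is_wiener_integral f W a t J -> (J : T -> R) \in L2.
Proof.
move=> hW at_ hJ; have [N [_ _ msN]] := wiener_approx at_ hJ ltr01.
apply: (ms_error_L2 (L2_rs_var f a t N hW)) => //.
exact: lt_trans msN (ltry _).
Qed.

(** The two limits defining the integral over the half-line are merged: a single
    Riemann-Stieltjes sum, over a long interval and with a fine mesh, is already
    close to the integral in L^2(P). *)
Lemma wiener_integral_Noo_approx f W t I : (forall u, (W u : T -> R) \in L2) ->
  is_wiener_integral_Noo f W t I ->
  (I : T -> R) \in L2 /\
  forall e M : R, 0 < e -> exists a N, [/\ a < t - M, a < t, (0 < N)%N, (t - a) / N%:R < e &
    ipP (fun w => rs_var f W a t N w - I w) (fun w => rs_var f W a t N w - I w) < e].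
Proof.
move=> hW [J hJ cJ].
have near_J e : 0 < e -> \forall a \near -oo, (mse (J a) I < e%:E)%E.
  move=> e0; have /cJ : ereal_nbhs (0%E : \bar R) (fun u => u < e%:E)%E
    by apply: open_ereal_lt'; rewrite lte_fin.
  exact.
have pick_a e M : 0 < e -> exists a, [/\ a < t - M, a < t & (mse (J a) I < e%:E)%E].
  move=> e0; have [K [_ HK]] := near_J _ e0.
  exists (Num.min (K - 1) (Num.min (t - M - 1) (t - 1))); split.
  - by rewrite !gt_min; apply/orP; right; apply/orP; left; rewrite ltrBlDr ltrDl.
  - by rewrite !gt_min; apply/orP; right; apply/orP; right; rewrite ltrBlDr ltrDl.
  - by apply: HK; rewrite gt_min ltrBlDr ltrDl ltr01.
have hI : (I : T -> R) \in L2.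
  have [a [_ at_ msa]] := pick_a 1 0 ltr01.
  apply: (ms_error_L2 (wiener_integral_L2 hW at_ (hJ _ at_))) => //.
  exact: lt_trans msa (ltry _).
split => // e M e0.
have e4 : 0 < e / 4 by rewrite divr_gt0.
have [a [aM at_ msa]] := pick_a (e / 4) M e4.
have hJa := wiener_integral_L2 hW at_ (hJ _ at_).
have [N [N0 mesh msN]] := wiener_approx at_ (hJ _ at_) e4.
exists a, N; split => //; first by apply: lt_trans mesh _; lra.
have hrs := L2_rs_var f a t N hW.
apply: le_lt_trans (ip_triangle hrs hJa hI) _.
rewrite ms_errorE// lte_fin in msa; rewrite ms_errorE// lte_fin in msN.
lra.
Qed.

Lemma ip_rs_var f W Y a t N : (forall u, (W u : T -> R) \in L2) -> Y \in L2 ->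
  ipP (rs_var f W a t N) Y =
  \sum_(0 <= i < N) f (node a t N i) *
    (ipP (W (node a t N i.+1)) Y - ipP (W (node a t N i)) Y).
Proof.
move=> hW hY.
rewrite (@ip_sum _ _ _ P N (fun i => f (node a t N i))
  (fun i w => W (node a t N i.+1) w - W (node a t N i) w))//; last by move=> i; exact: L2B.
by apply: eq_bigr => i _; rewrite ipBl.
Qed.

(** Along a sequence of Riemann-Stieltjes sums converging in L^2(P), the scalar
    products with Y converge both to that of the integral and, by [cvg_rs_sum], to
    the mean increment of r u = ip (W u) Y. *)
Lemma ip_wiener_integral (al : R) W t I Y C : 0 < al ->
  (forall u, (W u : T -> R) \in L2) -> Y \in L2 ->
  continuous (fun u => ipP (W u) Y) ->
  (forall u, `|ipP (W t) Y - ipP (W u) Y| <= C * (1 + `|t - u|)) ->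
  is_wiener_integral_Noo (fun u => expR (- al * (t - u))) W t I ->
  ipP I Y = \int[@expo R]_s (ipP (W t) Y - ipP (W (t - s / al)) Y).
Proof.
move=> al0 hW hY cr rC hI.
have [I2 app] := wiener_integral_Noo_approx hW hI.
pose f u := expR (- al * (t - u)); pose r u := ipP (W u) Y.
have en (n : nat) : 0 < n.+1%:R^-1 :> R by rewrite invr_gt0.
have /choice[aN HaN] : forall n : nat, exists aN : R * nat,
    [/\ aN.1 < t - n%:R, (0 < aN.2)%N, (t - aN.1) / aN.2%:R < n.+1%:R^-1 &
    ipP (fun w => rs_var f W aN.1 t aN.2 w - I w)
      (fun w => rs_var f W aN.1 t aN.2 w - I w) < n.+1%:R^-1].
  by move=> n; have [a [N [? ? ? ? ?]]] := app _ n%:R (en n); exists (a, N).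
have c1 : rs_sum al r t (aN n).1 (aN n).2 @[n --> \oo] --> \int[@expo R]_s (r t - r (t - s / al)).
  by apply: (@cvg_rs_sum _ al C r t (fun n => (aN n).1) (fun n => (aN n).2)) => // n;
    have [] := HaN n.
have c2 : rs_sum al r t (aN n).1 (aN n).2 @[n --> \oo] --> ipP I Y.
  have E n : rs_sum al r t (aN n).1 (aN n).2 = ipP (rs_var f W (aN n).1 t (aN n).2) Y.
    by rewrite ip_rs_var.
  apply/cvgrPdist_le => e e0.
  have [c c0 h2] := ip_young_weight (P := P) Y e0.
  near=> n; rewrite E distrC -ipBl//; last exact: L2_rs_var.
  apply: le_trans (ip_young c0 _ hY) _; first by apply: L2B => //; exact: L2_rs_var.
  have [_ _ _ msn] := HaN n.
  have nd : n.+1%:R^-1 < e / (2 * c).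
    near: n; apply: (near_infty_natSinv_lt (PosNum (_ : 0 < e / (2 * c)))).
    by rewrite divr_gt0// mulr_gt0.
  have h1 : c * ipP (fun w => rs_var f W (aN n).1 t (aN n).2 w - I w)
      (fun w => rs_var f W (aN n).1 t (aN n).2 w - I w) <= e / 2.
    rewrite -ler_pdivlMl//; apply: ltW; apply: lt_trans msn _; apply: lt_le_trans nd _.
    by rewrite le_eqVlt; apply/orP; left; apply/eqP; field; rewrite !gt_eqF.
  lra.
exact: cvg_unique c2 c1.
Unshelve. all: by end_near. Qed.

End wiener_integral.

(** * Covariance of the exponential Wiener integrals *)

Section fractional_ornstein_uhlenbeck.
Context {R : realType} {d : measure_display} {T : measurableType d}.
Context {P : probability T R}.
Variables (H : R) (W : R -> {RV P >-> R}).
Hypothesis p01 : 0 < 2 * H <= 1.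
Hypothesis W_fBm : fractional_brownian_motion H W.
Notation L2 := (Lfun P 2%:E).
Notation ipP := (ip (P := P)).
Notation G := (absp (2 * H)).

Lemma L2_fbm u : (W u : T -> R) \in L2.
Proof.
apply: L2_intro => //; have [_ _ /(_ u u)] := W_fBm; rewrite unlock => E.
rewrite (eq_integral (fun w => ((W u \* W u)%R w)%:E)); last first.
  by move=> w _; rewrite /= expr2.
by rewrite E ltry.
Qed.

Lemma ip_fbm u v : ipP (W u) (W v) = 2^-1 * (G u + G v - G (u - v)).
Proof. by rewrite /ip; have [_ _ ->] := W_fBm. Qed.

Lemma ip_incr_fbm u v :
  ipP (fun w => W u w - W v w) (fun w => W u w - W v w) = G (u - v).
Proof.
have hu := L2_fbm u; have hv := L2_fbm v.
rewrite ipBl//; last exact: L2B.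
rewrite 2!(ipC _ (fun w => _ - _)) !ipBl// !ip_fbm !subrr (absp0 p01).
have -> : G (v - u) = G (u - v) by rewrite -opprB abspN.
by field.
Qed.

Lemma ip_fbm_young (c : R) Y u v : 0 < c -> Y \in L2 ->
  `|ipP (W u) Y - ipP (W v) Y| <= c * G (u - v) + c^-1 * ipP Y Y.
Proof.
move=> c0 hY; rewrite -ipBl ?L2_fbm// -ip_incr_fbm; apply: ip_young => //.
by apply: L2B; exact: L2_fbm.
Qed.

(** From [ip_fbm_young], choosing first the weight c and then u - v. *)
Lemma continuous_ip_fbm Y : Y \in L2 -> continuous (fun u => ipP (W u) Y).
Proof.
move=> hY u; apply/cvgrPdist_le => e e0.
have [c c0 h2] := ip_young_weight (P := P) Y e0.
have ec0 : 0 < e / 2 / c by apply: divr_gt0 => //; exact: divr_gt0.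
have [del del0 hdel] := absp_small p01 ec0.
near=> v; apply: le_trans (ip_fbm_young u v c0 hY) _.
have h1 : c * G (u - v) <= e / 2.
  rewrite mulrC -ler_pdivlMr//; apply: hdel; near: v; exact: cvgr_dist_le.
lra.
Unshelve. all: by end_near. Qed.

Lemma ip_fbm_growth Y t u : Y \in L2 ->
  `|ipP (W t) Y - ipP (W u) Y| <= (1 + ipP Y Y) * (1 + `|t - u|).
Proof.
move=> hY; apply: le_trans (ip_fbm_young t u ltr01 hY) _.
rewrite invr1 !mul1r; have := absp_le1D p01 (t - u).
have Y0 := @ip_ge0 _ _ _ P Y.
have : 0 <= ipP Y Y * `|t - u| by rewrite mulr_ge0.
lra.
Qed.

Notation kernel al t := (fun u => expR (- al * (t - u))).

Variable al : R.
Hypothesis al0 : 0 < al.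

Let L2_I t (I : {RV P >-> R}) : is_wiener_integral_Noo (kernel al t) W t I ->
  (I : T -> R) \in L2.
Proof. by move=> /(wiener_integral_Noo_approx L2_fbm)[]. Qed.

(** The stationary solution as a mean increment of W, tested against Y. *)
Lemma ip_ou t (I : {RV P >-> R}) Y : is_wiener_integral_Noo (kernel al t) W t I ->
  Y \in L2 ->
  ipP I Y = \int[@expo R]_s (ipP (W t) Y - ipP (W (t - s / al)) Y).
Proof.
move=> hI hY; apply: (@ip_wiener_integral _ _ _ _ al W t I Y (1 + ipP Y Y)) => //.
- exact: L2_fbm.
- exact: continuous_ip_fbm.
- by move=> u; exact: ip_fbm_growth.
Qed.

Lemma expectation_ou t (I : {RV P >-> R}) :
  is_wiener_integral_Noo (kernel al t) W t I -> ('E_P[I] = 0)%E.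
Proof.
move=> hI; have h1 : (cst 1 : T -> R) \in L2 by exact: Lfun_cst.
have E1 (X : T -> R) : X \* cst 1 = X by apply/funext => w /=; rewrite mulr1.
have := expectation_ip (L2_I hI) h1; rewrite E1 => ->.
rewrite (ip_ou hI h1); congr (_%:E).
rewrite -[RHS]expo_Rintegral_cst; apply: eq_Rintegral => s _.
by rewrite /ip !E1; have [_ E0 _] := W_fBm; rewrite !E0 subrr.
Qed.

Let scaled_incr (s z : R) : incr (s / al) G z = G al^-1 * incr s G (al * z).
Proof.
rewrite /incr mulrBr -!abspM mulrDr mulKf ?gt_eqF//.
by rewrite (mulrC _ s).
Qed.

(** [ip_ou] is applied with Y = W w to find the function w |-> ip (W w) Is, and then
    with Y = Is.  The terms in |s|^(2H) and |w|^(2H) of the covariance of W drop out of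
    the increments, which leaves a function of t - s; scaling the steps by 1 / al
    produces the factor al^(-2H). *)
Lemma ip_ou_ou t s (It Is : {RV P >-> R}) :
  is_wiener_integral_Noo (kernel al t) W t It ->
  is_wiener_integral_Noo (kernel al s) W s Is ->
  ipP It Is = G al^-1 * fou_cov (2 * H) (al * (t - s)).
Proof.
move=> hIt hIs; have one1 := normr1 R; have oneN := normrN1 R.
have holderG : absp_holder_with (2 * H) 1 G.
  by move=> x y; rewrite mul1r; exact: absp_holder.
pose U := mean_incr_absp (2 * H).
have ipWI u v : ipP (W u) Is - ipP (W v) Is =
    2^-1 * G al^-1 * (U (al * (u - s)) - U (al * (v - s))).
  have iG w : (@expo R).-integrable setT
      (EFin \o (fun y => G al^-1 * incr (1 * y) G (al * (w - s)))).
    exact: integrable_mulr (integrable_incr p01 _ one1 holderG).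
  have i0 : (@expo R).-integrable setT (EFin \o (fun y => G s - G (s - y / al))).
    have := integrable_mulr (- G al^-1)
      (integrable_incr p01 (al * s) oneN holderG).
    apply: eq_integrable => // y _ /=; congr (_%:E).
    rewrite /incr mulN1r mulNr mulrBr -!abspM mulrDr mulKf ?gt_eqF//.
    by rewrite mulrN (mulrC _ y); ring.
  have EI w : ipP (W w) Is = 2^-1 * \int[@expo R]_y
      (G s - G (s - y / al) + G al^-1 * incr (1 * y) G (al * (w - s))).
    rewrite ipC (ip_ou hIs (L2_fbm w)) -RintegralZl//; last first.
      exact: integrable_addr i0 (iG w).
    apply: eq_Rintegral => y _; rewrite !ip_fbm mul1r -scaled_incr /incr.
    rewrite -(abspN (2 * H) (s - w)) -(abspN (2 * H) (s - y / al - w)).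
    rewrite (_ : - (s - w) = w - s); last ring.
    rewrite (_ : - (s - y / al - w) = w - s + y / al); last ring.
    ring.
  have EU w : ipP (W w) Is = 2^-1 * (\int[@expo R]_y (G s - G (s - y / al)) +
      G al^-1 * U (al * (w - s))).
    rewrite EI (RintegralD measurableT i0 (iG w)).
    by rewrite (RintegralZl _ measurableT (integrable_incr p01 _ one1 holderG)).
  by rewrite !EU; ring.
rewrite (ip_ou hIt (L2_I hIs)).
have hU := holder_mean_incr_absp p01.
rewrite /fou_cov /mean_incr.
have iU := integrable_incr p01 (al * (t - s)) oneN hU.
rewrite mulrA -RintegralZl//; apply: eq_Rintegral => y _.
rewrite ipWI /incr -/U.
have -> : al * (t - y / al - s) = al * (t - s) + -1 * y.
  by field; rewrite gt_eqF.
ring.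
Qed.

End fractional_ornstein_uhlenbeck.

(** * Autocovariance and spectral density of the stationary solution *)

Section covariance_of_the_solution.
Context {R : realType} {d : measure_display} {T : measurableType d}.
Context {P : probability T R}.
Variables (H sigma al : R) (W x : R -> {RV P >-> R}).
Hypothesis p01 : 0 < 2 * H <= 1.
Hypothesis al0 : 0 < al.
Hypothesis W_fBm : fractional_brownian_motion H W.
Hypothesis x_sol : stationary_solution W (- al) sigma x.
Notation L2 := (Lfun P 2%:E).
Notation ipP := (ip (P := P)).
Notation v := (fou_cov (2 * H)).

Let expectation_ae (X Y : T -> R) : measurable_fun setT X -> measurable_fun setT Y ->
  {ae P, forall w, X w = Y w} -> ('E_P[X] = 'E_P[Y])%E.
Proof.
move=> mX mY XY; rewrite unlock; apply: ae_eq_integral => //.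
- exact/measurable_EFinP.
- exact/measurable_EFinP.
- by apply: filterS XY => w /= ->.
Qed.

Lemma expectation_sol t : ('E_P[x t] = 0)%E.
Proof.
have [I hI xI] := x_sol t.
have I2 : (I : T -> R) \in L2.
  by have [] := wiener_integral_Noo_approx (L2_fbm W_fBm) hI.
rewrite (expectation_ae _ _ xI)//; last exact: L2_measurable (L2Z sigma I2).
have I1 : (I : T -> R) \in Lfun P 1.
  by apply: Lfun_subset12 I2; exact: fin_num_measure.
have -> : (fun w => sigma * I w) = sigma \o* I.
  by apply/funext => w /=; rewrite mulrC.
by rewrite expectationZl// (expectation_ou p01 W_fBm al0 hI) mule0.
Qed.

Definition fou_scale : R := sigma ^+ 2 * absp (2 * H) al^-1.

Lemma expectation_sol_mul s t :
  ('E_P[(x s \* x t)%R])%E = (fou_scale * v (al * (t - s)))%:E.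
Proof.
have [Is hIs xIs] := x_sol s; have [It hIt xIt] := x_sol t.
have Is2 : (Is : T -> R) \in L2.
  by have [] := wiener_integral_Noo_approx (L2_fbm W_fBm) hIs.
have It2 : (It : T -> R) \in L2.
  by have [] := wiener_integral_Noo_approx (L2_fbm W_fBm) hIt.
have hS := L2Z sigma Is2; have hT := L2Z sigma It2.
rewrite (@expectation_ae _ ((fun w => sigma * It w) \* (fun w => sigma * Is w))%R).
- rewrite expectation_ip// ipZl// ipC ipZl// ipC.
  rewrite (ip_ou_ou p01 W_fBm al0 hIt hIs) /fou_scale; congr (_%:E); ring.
- by apply: measurable_funM.
- exact: measurable_funM (L2_measurable hT) (L2_measurable hS).
- by apply: filterS2 xIs xIt => w /= -> ->; rewrite mulrC.
Qed.

Lemma cov_sol s t : cov x s t = (fou_scale * v (al * (t - s)))%:E.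
Proof. by rewrite /cov expectation_sol_mul !expectation_sol mule0 sube0. Qed.

Lemma autocovariance_sol tau : autocovariance x tau = fou_scale * v (al * tau).
Proof. by rewrite /autocovariance cov_sol subr0. Qed.

Lemma weakly_stationary_sol : weakly_stationary x.
Proof.
split => [t|t|t tau]; first by rewrite expectation_sol_mul ltry.
  by rewrite !expectation_sol.
by rewrite !cov_sol (addrC t) addrK subr0.
Qed.

Hypothesis sigma0 : sigma != 0.

Lemma fou_scale_gt0 : 0 < fou_scale.
Proof.
rewrite mulr_gt0//; first by rewrite exprn_even_gt0.
by rewrite powR_gt0// normr_gt0 invr_eq0 gt_eqF.
Qed.

(** The symmetry of [fou_cov] is that of the covariance of the process, whose value
    at lag al^-1 * tau is a nonzero multiple of it. *)
Lemma fou_cov_even tau : v (- tau) = v tau.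
Proof.
have H' s t : v (al * (t - s)) = v (al * (s - t)).
  apply: (@mulfI _ fou_scale); first exact: lt0r_neq0 fou_scale_gt0.
  have E : (x s \* x t)%R = (x t \* x s)%R :> (T -> R).
    by apply/funext => w /=; rewrite mulrC.
  have := expectation_sol_mul s t; rewrite E expectation_sol_mul.
  by move=> h; exact: (esym (EFin_inj h)).
have := H' (al^-1 * tau) 0.
by rewrite sub0r subr0 mulrN mulVKf ?gt_eqF.
Qed.

Notation C := (cos_transform v).

Let al_neq0 : al != 0. Proof. by rewrite gt_eqF. Qed.

Let iv : lebesgue_measure.-integrable setT (EFin \o v) := integrable_fou_cov p01.

Lemma integrable_autocovariance :
  lebesgue_measure.-integrable setT (EFin \o autocovariance x).
Proof.
have := integrable_mulr fou_scale (integrable_affine 0 al_neq0 iv).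
apply: eq_integrable => // t _ /=.
by rewrite autocovariance_sol addr0.
Qed.

Let complex_mulr_real (k : R) (z : R[i]) :
  (complex.Re (k%:C%C * z) = k * complex.Re z) * (complex.Im (k%:C%C * z) = k * complex.Im z).
Proof. by case: z => a b /=; rewrite !mul0r subr0 addr0. Qed.

Let expi_mulr (theta k : R) :
  (complex.Re (expi theta * k%:C%C) = cos theta * k) *
  (complex.Im (expi theta * k%:C%C) = sin theta * k).
Proof. by rewrite /expi /=; rewrite !mulr0 subr0 add0r. Qed.

Definition spectral_scale : R := (2 * pi)^-1 * (fou_scale * al^-1).

Lemma spectral_scale_gt0 : 0 < spectral_scale.
Proof.
rewrite /spectral_scale; apply: mulr_gt0; first by rewrite invr_gt0 mulr_gt0// pi_gt0.
by apply: mulr_gt0; [exact: fou_scale_gt0|rewrite invr_gt0].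
Qed.

(** The substitution y = al t in the Fourier integral. *)
Lemma real_spectral_density_sol w :
  real_spectral_density x w = spectral_scale * C (w / al).
Proof.
rewrite /real_spectral_density /process_spectral_density /spectral_density.
rewrite complex_mulr_real /spectral_scale -mulrA; congr (_ * _).
have i := integrable_mulr fou_scale (integrable_cosM iv (w / al)).
rewrite -[LHS]/(\int[lebesgue_measure]_t
  complex.Re (expi (- (w * t)) * (autocovariance x t)%:C%C)).
rewrite (_ : fou_scale * al^-1 * C (w / al) =
    `|al|^-1 * (fou_scale * C (w / al))); last by rewrite gtr0_norm//; ring.
rewrite -(RintegralZl fou_scale measurableT (integrable_cosM iv (w / al))).
rewrite -(Rintegral_affine 0 al_neq0 i); apply: eq_Rintegral => t _.
rewrite expi_mulr autocovariance_sol cosN addr0 [w / al * _]mulrA divfK//.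
by ring.
Qed.

(** The imaginary part is the sine transform of an even function. *)
Lemma process_spectral_density_real w : complex.Im (process_spectral_density x w) = 0.
Proof.
rewrite /process_spectral_density /spectral_density complex_mulr_real.
rewrite -[X in _ * X]/(\int[lebesgue_measure]_t
  complex.Im (expi (- (w * t)) * (autocovariance x t)%:C%C)).
have even t : autocovariance x (- t) = autocovariance x t.
  by rewrite !autocovariance_sol mulrN fou_cov_even.
have := sin_transform0 integrable_autocovariance (- w) even.
suff -> : \int[lebesgue_measure]_t
    complex.Im (expi (- (w * t)) * (autocovariance x t)%:C%C) =
    \int[lebesgue_measure]_t (sin (- w * t) * autocovariance x t).
  by move=> ->; rewrite mulr0.
by apply: eq_Rintegral => t _; rewrite expi_mulr mulNr.
Qed.

Lemma real_spectral_density_vanishes (e : R) : 0 < e ->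
  exists2 M : R, 0 < M & forall w, M <= `|w| -> `|real_spectral_density x w| <= e.
Proof.
have k0 := spectral_scale_gt0.
move=> e0; have [M M0 HM] := cos_transform_vanishes iv (@fou_cov_shift _ _ p01) (divr_gt0 e0 k0).
exists (M * al); first exact: mulr_gt0.
move=> w Mw; rewrite real_spectral_density_sol normrM gtr0_norm// mulrC.
rewrite -ler_pdivlMr//; apply: HM.
by rewrite normrM normrV ?unitfE// (gtr0_norm al0) ler_pdivlMr.
Qed.

Lemma spectral_max_well_defined_sol : spectral_max_well_defined x.
Proof.
have k0 := spectral_scale_gt0.
split.
- exact: weakly_stationary_sol.
- exact: integrable_autocovariance.
- exact: process_spectral_density_real.
split.
- exists (spectral_scale * \int[lebesgue_measure]_t `|v t|) => w.
  rewrite real_spectral_density_sol normrM gtr0_norm// ler_pM2l//.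
  exact: cos_transform_bounded.
- apply/cvgrPdist_le => e e0.
  have [M M0 HM] := real_spectral_density_vanishes e0.
  near=> w; rewrite sub0r normrN; apply: HM.
  by apply: le_trans (ler_norm w); near: w; apply: nbhs_pinfty_ge; exact: num_real.
- apply/cvgrPdist_le => e e0.
  have [M M0 HM] := real_spectral_density_vanishes e0.
  near=> w; rewrite sub0r normrN; apply: HM.
  rewrite -normrN; apply: le_trans (ler_norm (- w)); rewrite lerNr.
  by near: w; apply: nbhs_ninfty_le; exact: num_real.
- have [w0 [_ Hw0]] := cos_transform_max (@continuous_fou_cov _ _ p01) iv
    (@fou_cov_shift _ _ p01) (fou_cov0_gt0 p01).
  exists (al * w0) => w; rewrite !real_spectral_density_sol ler_pM2l//.
  by rewrite [al * w0]mulrC mulfK.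
Unshelve. all: by end_near. Qed.

Lemma spectral_max_sol (w0 : R) : (forall w, C w <= C w0) ->
  spectral_max x = spectral_scale * C w0.
Proof.
move=> Hw0; have k0 := spectral_scale_gt0.
have S0 : real_spectral_density x (al * w0) = spectral_scale * C w0.
  by rewrite real_spectral_density_sol [al * w0]mulrC mulfK.
have ub : ubound (range (real_spectral_density x)) (spectral_scale * C w0).
  by move=> _ [w _ <-]; rewrite real_spectral_density_sol ler_pM2l.
apply/eqP; rewrite eq_le; apply/andP; split.
  by apply: ge_sup => //; exists (spectral_scale * C w0), (al * w0).
by rewrite -S0; apply: ub_le_sup; [exists (spectral_scale * C w0)|exists (al * w0)].
Qed.

End covariance_of_the_solution.

(** * Asymptotic order of the spectral maximum *)

(** The lower and upper limits of an eventually constant quotient are that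
    constant. *)
Lemma same_order_at_left_proportional (R : realType) (b1 b2 : R -> R) (c lstar : R) :
  0 < c -> (forall l, l < lstar -> b1 l / b2 l = c) ->
  same_order_at_left b1 b2 lstar.
Proof.
move=> c0 bc; rewrite /same_order_at_left.
set q := fun l => (`|b1 l / b2 l|)%:E.
have qc l : l < lstar -> q l = c%:E by move=> ll; rewrite /q bc// gtr0_norm.
have nl : (at_left lstar) [set l | l < lstar] by exact: nbhs_left_lt.
have qV V : (at_left lstar) V -> exists2 l, V l & q l = c%:E.
  move=> hV; have /filter_ex[l [Vl ll]] :
    (at_left lstar) (V `&` [set l | l < lstar]) by exact: filterI.
  by exists l => //; exact: qc.
have qimg : q @` [set l | l < lstar] = [set c%:E].
  apply/seteqP; split => [_ [l ll <-]|_ ->]; first by rewrite /= qc.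
  by exists (lstar - 1) => /=; [rewrite ltrBlDr ltrDl|rewrite qc// ltrBlDr ltrDl].
have E1 : limf_esup q (at_left lstar) = c%:E.
  rewrite limf_esupE; apply/eqP; rewrite eq_le; apply/andP; split.
    by apply: ereal_inf_lbound; exists [set l | l < lstar] => //; rewrite qimg ereal_sup1.
  apply: le_ereal_inf_tmp => _ [V hV <-].
  by have [l Vl <-] := qV V hV; apply: ereal_sup_ubound; exists l.
have E2 : limf_einf q (at_left lstar) = c%:E.
  rewrite limf_einfE; apply/eqP; rewrite eq_le; apply/andP; split.
    apply: ge_ereal_sup => _ [V hV <-].
    by have [l Vl <-] := qV V hV; apply: ereal_inf_lbound; exists l.
  by apply: ereal_sup_ubound; exists [set l | l < lstar] => //; rewrite qimg ereal_inf1.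
by rewrite E1 E2; split; rewrite ?lte_fin ?ltry.
Qed.

Theorem lemma3p6 (R : realType) (d : measure_display) (T : measurableType d)
    (P : probability T R) (lstar : R) (A : R -> R) (H sigma : R)
    (W : R -> {RV P >-> R}) (x : R -> R -> {RV P >-> R})
    (A_continuous : {within [set l : R | l <= lstar], continuous A})
    (A_lt0 : forall l, l < lstar -> A l < 0)
    (A_lstar : A lstar = 0)
    (H_gt0 : 0 < H) (H_le_half : H <= 2^-1)
    (sigma_neq0 : sigma != 0)
    (W_fBm : fractional_brownian_motion H W)
    (x_sol : forall l, l < lstar -> stationary_solution W (A l) sigma (x l)) :
  (forall l, l < lstar -> spectral_max_well_defined (x l)) /\
  same_order_at_left (fun l => spectral_max (x l))
    (fun l => `|A l| `^ (- 1 - 2 * H)) lstar.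
Proof.
have p01 : 0 < 2 * H <= 1.
  by rewrite mulr_gt0//= mulrC -ler_pdivlMr// mul1r.
have al0 l : l < lstar -> 0 < - A l by move=> ll; rewrite oppr_gt0 A_lt0.
have sol l : l < lstar -> stationary_solution W (- - A l) sigma (x l).
  by move=> ll; rewrite opprK; exact: x_sol.
split=> [l ll|].
  exact: (spectral_max_well_defined_sol p01 (al0 l ll) W_fBm (sol l ll)).
have [w0 [Cw0 Hw0]] := cos_transform_max (@continuous_fou_cov _ _ p01)
  (integrable_fou_cov p01) (@fou_cov_shift _ _ p01) (fou_cov0_gt0 p01).
apply: (@same_order_at_left_proportional _ _ _
  ((2 * pi)^-1 * sigma ^+ 2 * cos_transform (fou_cov (2 * H)) w0)).
  apply: mulr_gt0 => //; apply: mulr_gt0; last by rewrite exprn_even_gt0.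
  by rewrite invr_gt0 mulr_gt0// pi_gt0.
move=> l ll; have a0 := al0 l ll.
rewrite (spectral_max_sol p01 a0 W_fBm (sol l ll) sigma_neq0 Hw0).
rewrite /spectral_scale /fou_scale /absp -(normrN (A l)) !gtr0_norm ?invr_gt0//.
move: (- A l) a0 => al al_gt0.
have -> : al `^ (- 1 - 2 * H) = al^-1 * al^-1 `^ (2 * H).
  rewrite powRD; last by rewrite (gt_eqF al_gt0) implybT.
  rewrite powR_inv1 ?ltW//; congr (_ * _).
  by rewrite -[X in _ = X `^ _]powR_inv1 ?(ltW al_gt0)// -powRrM mulN1r.
have g0 : al^-1 `^ (2 * H) != 0 by rewrite gt_eqF// powR_gt0// invr_gt0.
move: (pi : R) (pi_gt0 R) => q q0.
by field; rewrite g0 !gt_eqF.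
Qed.
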